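(* Let $\omega\in\mathcal{W}_0$ with associated weight matrix $\mathcal{M}_\omega=\{\mathbf{W}^{(\ell)}:\ell>0\}$ and let $\alpha>0$. Assume: (i) there exists $\ell_0>0$ such that $\gamma(\mathbf{W}^{(\ell_0)})>\alpha$; (ii) $\omega(t)=o(t^{1/\alpha})$ as $t\to+\infty$. Then, with $\frac{\mathcal{M}_\omega}{\mathbf{G}^\alpha}:=\left\{\frac{\mathbf{W}^{(\ell)}}{\mathbf{G}^\alpha}:\ell>0\right\}$, as locally convex vector spaces, for all $c,\ell>0$: $$\mathfrak{F}_{\left[\frac{\mathcal{M}_\omega}{\mathbf{G}^\alpha}\right]}=\mathfrak{F}_{[\omega_{\mathbf{W}^{(c\ell_0)}/\mathbf{G}^\alpha}]}=\mathfrak{F}_{[\omega_{\mathbf{W}^{(\ell)}}\widehat{\star}\,\omega_{\mathbf{G}^\alpha}]}=\mathfrak{F}_{[\omega\widehat{\star}\,\omega_{\mathbf{G}^\alpha}]}=\mathfrak{F}_{[\omega\widehat{\star}\,\mathrm{id}^{1/\alpha}]}=\mathfrak{F}_{[(((\omega^\alpha)^\star)^\iota)^{1/\alpha}]}$$ for every $\mathfrak{F}\in\{\mathcal{E},\mathcal{B},\mathcal{A},\mathcal{S},\Lambda,\mathcal{F}\}$, in both the Roumieu case $[\cdot]=\{\cdot\}$ and the Beurling case $[\cdot]=(\cdot)$.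
   Context: $\mathbb{N}=\{0,1,2,\dots\}$. Weight functions. $\mathcal{W}_0$ is the set of all continuous, non-decreasing $\omega:[0,+\infty)\to[0,+\infty)$ with $\omega(t)=0$ for $t\in[0,1]$, $\lim_{t\to+\infty}\omega(t)=+\infty$, $\log t=o(\omega(t))$ as $t\to+\infty$, and $\varphi_\omega:t\mapsto\omega(e^t)$ convex on $\mathbb{R}$. Associated weight matrix: $\varphi^*_\omega(x):=\sup_{y\ge0}\{xy-\varphi_\omega(y)\}$, $x\ge0$, and $\mathcal{M}_\omega:=\{\mathbf{W}^{(\ell)}:\ell>0\}$ with $W^{(\ell)}_p:=\exp(\frac1\ell\varphi^*_\omega(\ell p))$, $p\in\mathbb{N}$. Each $\mathbf{W}^{(\ell)}$ is log-convex with $W^{(\ell)}_0=1$ and $(W^{(\ell)}_p)^{1/p}\to+\infty$. Associated weight function. For a positive sequence $\mathbf{M}$ with $M_0=1$: $\omega_{\mathbf{M}}(t):=\sup_{p\in\mathbb{N}}\log(t^p/M_p)$, $t\ge0$ (with $0^0:=1$). $\mathbf{M}/\mathbf{N}:=(M_p/N_p)_p$; $\mathbf{G}^\alpha:=(p!^\alpha)_p$. Growth index of Thilliez for a log-convex positive sequence $\mathbf{M}$ with $M_0=1$, $M_p^{1/p}\to+\infty$: with $\mu_p:=M_p/M_{p-1}$ ($p\ge1$), $\gamma(\mathbf{M})$ is the supremum of all $\beta>0$ for which there are a constant $a\ge1$ and a non-decreasing positive sequence $(\lambda_p)_{p\ge1}$ with $a^{-1}\lambda_p\le\mu_pp^{-\beta}\le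 a\lambda_p$ for all $p\ge1$ ($\gamma(\mathbf{M}):=0$ if there is none). It is known that, for $\beta\ge0$, $\gamma(\mathbf{M})>\beta$ holds if and only if there is an integer $Q\ge2$ with $\liminf_{p\to+\infty}\mu_{Qp}/\mu_p>Q^\beta$. Conjugates. $\sigma\widehat{\star}\tau(t):=\sup_{s\ge0}\{\sigma(s)-\tau(s/t)\}$ for $t>0$ and $\sigma\widehat{\star}\tau(0):=\sigma(0)-\tau(0)$; $\mathrm{id}^{1/\alpha}(t):=t^{1/\alpha}$. For a function $h$: $h^\iota(t):=h(1/t)$ ($t>0$), $h^\beta(t):=h(t^\beta)$ for $\beta>0$, $h^\star(t):=\sup_{s\ge0}\{h(s)-ts\}$. Thus $(((\omega^\alpha)^\star)^\iota)^{1/\alpha}(t)=\sup_{s\ge0}\{\omega(s^\alpha)-st^{-1/\alpha}\}$ for $t>0$, with value $0$ at $t=0$. Weighted spaces. For a positive sequence $a=(a_p)_p$ consider the following (semi-)norms: $\mathcal{E}$: for $f\in C^\infty(U)$, $U\subseteq\mathbb{R}^d$ non-empty open, $K\subset U$ compact: $\sup_{x\in K,\beta\in\mathbb{N}^d}|\partial^\beta f(x)|/a_{|\beta|}$; $\mathcal{B}$: for $f\in C^\infty(U)$: $\sup_{x\in U,\beta\in\mathbb{N}^d}|\partial^\beta f(x)|/a_{|\beta|}$; $\mathcal{A}$: for $f$ holomorphic on an unbounded sector $S$ (of the Riemann surface of the logarithm): $\sup_{z\in S,p\in\mathbb{N}}|f^{(p)}(z)|/a_p$; $\mathcal{S}$: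 for $f\in C^\infty(\mathbb{R})$: $\sup_{x\in\mathbb{R},j,k\in\mathbb{N}}(1+|x|)^k|f^{(j)}(x)|/a_{j+k}$; $\Lambda$: for complex sequences $(c_p)_p$: $\sup_p|c_p|/a_p$; $\mathcal{F}$: for formal power series $\sum_pc_px^p$ with complex coefficients: $\sup_p|c_p|/a_p$. For a family $\mathcal{M}=\{\mathbf{M}^{(\ell)}:\ell>0\}$ of positive sequences: $\mathfrak{F}_{(\mathcal{M})}$ consists of the elements for which these quantities are finite with $a=(h^pM^{(\ell)}_p)_p$ for all $\ell,h>0$ (and all $K$ if $\mathfrak{F}=\mathcal{E}$), with the topology generated by them; $\mathfrak{F}_{\{\mathcal{M}\}}$ requires finiteness for some $\ell,h>0$ (for $\mathcal{E}$: for every $K$ there exist $\ell,h>0$), with the inductive limit topology over $(\ell,h)$ (for $\mathcal{E}$: projective limit over $K$ of inductive limits). For a non-decreasing $\omega:[0,+\infty)\to[0,+\infty)$ with $\log t=o(\omega(t))$, $\mathfrak{F}_{(\omega)}$ and $\mathfrak{F}_{\{\omega\}}$ are defined in the same way with $a=\mathbf{W}^{(\ell)}$, $\ell>0$, and no factor $h^p$, where $W^{(\ell)}_p=\exp(\frac1\ell\varphi^*_\omega(\ell p))$ and, if $\omega$ is not zero on $[0,1]$, $\varphi^*_\omega(x):=\sup_{y\in\mathbb{R}}\{xy-\omega(e^y)\}$ (for $\omega\in\mathcal{W}_0$ both suprema agree). $[\cdot]$ denotes either $\{\cdot\}$ or $(\cdot)$, the same choice throughout a formula. *)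

(* Defs.v *)
From HB Require Import structures.
From mathcomp Require Import all_boot all_order all_algebra.
From mathcomp Require Import complex.
From mathcomp Require Import all_classical all_reals all_analysis.

Set Implicit Arguments.
Unset Strict Implicit.
Unset Printing Implicit Defensive.

Import Order.TTheory GRing.Theory Num.Theory.
Import numFieldNormedType.Exports.

Local Open Scope classical_set_scope.
Local Open Scope ring_scope.

(* Functions on [0, +oo[ are represented by functions on R whose values at
   negative arguments are irrelevant: no definition below evaluates them
   there. *)

Section Weights.
Context {R : realType}.

(* The definition behind the library's [f =o_F g], whose notation has no
   instance for the filter of neighbourhoods of +oo. *)
Definition littleo_pinfty (f g : R -> R) : Prop :=
  forall e : R, 0 < e -> \forall t \near +oo, `|f t| <= e * `|g t|.

Record weight0 (w : R -> R) : Prop := Weight0 {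
  weight0_cont : {within `[0, +oo[, continuous w} ;
  weight0_ge0 : forall t : R, 0 <= t -> 0 <= w t ;
  weight0_nd : forall s t : R, 0 <= s -> s <= t -> w s <= w t ;
  weight0_eq0 : forall t : R, 0 <= t <= 1 -> w t = 0 ;
  weight0_pinfty : w t @[t --> +oo] --> +oo ;
  weight0_log : littleo_pinfty (@ln R) w ;
  weight0_convex : convex_function setT (fun t : R^o => w (expR t) : R^o)
}.

(* The suprema in [phi_star] and [phi_starR] are over bounded sets as soon as
   ln = o(w) and w >= 0. *)
Definition phi_star (w : R -> R) (x : R) : R :=
  sup [set x * y - w (expR y) | y in `[0, +oo[].

Definition phi_starR (w : R -> R) (x : R) : R :=
  sup [set x * y - w (expR y) | y in setT].

Definition weight_seq (phi : R -> R) (l : R) (p : nat) : R :=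
  expR (l^-1 * phi (l * p%:R)).

Definition wmatrix (w : R -> R) : R -> nat -> R := weight_seq (phi_star w).

(* For weights that need not vanish on [0, 1]; it agrees with [wmatrix] for those
   that do. *)
Definition wmatrixR (w : R -> R) : R -> nat -> R := weight_seq (phi_starR w).

Definition gevrey (a : R) (p : nat) : R := p`!%:R `^ a.

Definition seq_div (M N : nat -> R) (p : nat) : R := M p / N p.

(* [lne 0 = -oo], so this is right at t = 0 as well, with 0 ^+ 0 = 1. *)
Definition assoc_weight (M : nat -> R) (t : R) : \bar R :=
  ereal_sup [set lne (t ^+ p / M p)%:E | p in [set: nat]].

Definition quotient_seq (M : nat -> R) (p : nat) : R := M p / M p.-1.

Definition thilliez_exponent (M : nat -> R) (b : R) : Prop :=
  exists (a : R) (lam : nat -> R),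
    [/\ 1 <= a,
        forall p, (1 <= p)%N -> 0 < lam p,
        forall p q, (1 <= p)%N -> (p <= q)%N -> lam p <= lam q
      & forall p, (1 <= p)%N ->
          a^-1 * lam p <= quotient_seq M p * p%:R `^ (- b) <= a * lam p].

Definition thilliez_index (M : nat -> R) : \bar R :=
  ereal_sup (0%E |` [set b%:E | b in [set b | 0 < b /\ thilliez_exponent M b]]).

Definition hat_star (s t : R -> \bar R) (x : R) : \bar R :=
  if x == 0 then (s 0%R - t 0%R)%E
  else ereal_sup [set (s y - t (y / x)%R)%E | y in `[0, +oo[].

Definition id_root (a : R) (t : R) : \bar R := (t `^ a^-1)%:E.

Definition star (h : R -> \bar R) (t : R) : \bar R :=
  ereal_sup [set (h s - (t * s)%R%:E)%E | s in `[0, +oo[].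

(* h(1/t), extended by the value 0 at t = 0. *)
Definition recip (h : R -> \bar R) (t : R) : \bar R :=
  if t == 0 then 0%E else h t^-1.

Definition dil (b : R) (h : R -> \bar R) (t : R) : \bar R := h (t `^ b).

(* The functions for which the spaces attached to a weight function are
   defined. *)
Record admissible (s : R -> \bar R) : Prop := Admissible {
  admissible_fin : forall t : R, 0 <= t -> (0 <= s t < +oo)%E ;
  admissible_nd : forall t u : R, 0 <= t -> t <= u -> (s t <= s u)%E ;
  admissible_log : littleo_pinfty (@ln R) (fine \o s)
}.

End Weights.

Definition Cx (R : realType) : numFieldType := R[i].

Section LocallyConvex.
Context {R : realType} {T : Type}.
Local Notation V := (T -> Cx R).

(* A subset of V together with the collection of its open subsets. Equality of
   two such records is equality of the vector spaces and of the topologies. *)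
Record lcs := LCS { carrier : set V ; opens : set (set V) }.

Definition seminormed (X0 : set V) (q : V -> \bar R) : lcs :=
  let X := [set f | X0 f /\ (q f < +oo)%E] in
  LCS X [set O | O `<=` X /\ forall f, O f ->
    exists2 e : R, 0 < e & forall g, X g -> (q (g - f)%R < e%:E)%E -> O g].

(* The coarsest topology on the intersection making all inclusions
   continuous. *)
Definition proj_lim (J : Type) (L : J -> lcs) : lcs :=
  let X := \bigcap_j carrier (L j) in
  LCS X [set O | O `<=` X /\ forall f, O f ->
    exists (s : set J) (B : J -> set V),
      [/\ finite_set s,
          forall j, s j -> opens (L j) (B j) /\ B j f
        & X `&` \bigcap_(j in s) B j `<=` O]].

Definition abs_convex (D : set V) : Prop :=
  forall (f g : V) (a b : Cx R), D f -> D g -> `|a| + `|b| <= 1 ->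
    D (fun x => a * f x + b * g x).

(* The finest locally convex topology on the union making all inclusions
   continuous: a base of 0-neighbourhoods is given by the absolutely convex sets
   that meet each step in a 0-neighbourhood of that step. *)
Definition ind_lim (J : Type) (L : J -> lcs) : lcs :=
  let X := \bigcup_j carrier (L j) in
  LCS X [set O | O `<=` X /\ forall f, O f ->
    exists D : set V,
      [/\ abs_convex D, D `<=` X,
          forall j, exists B, [/\ opens (L j) B, B 0 & B `<=` D]
        & forall g, D g -> O (f + g)]].

End LocallyConvex.
Arguments lcs : clear implicits.

Inductive kind := Roumieu | Beurling.

Definition step_lim {R : realType} {T : Type} (k : kind) {J : Type}
    (L : J -> lcs R T) : lcs R T :=
  if k is Roumieu then ind_lim L else proj_lim L.

(* What is needed to define a weighted space: functions on [wc_dom] that belong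
   to [wc_base], and, for every positive sequence a, a seminorm for each index
   in [wc_idx]. The index set is the set of compact subsets of U for the class E
   and a singleton for the other classes. *)
Record wclass (R : realType) := WClass {
  wc_dom : Type ;
  wc_idx : Type ;
  wc_base : set (wc_dom -> Cx R) ;
  wc_norm : wc_idx -> (nat -> R) -> (wc_dom -> Cx R) -> \bar R
}.

Section WeightedSpaces.
Context {R : realType}.

Definition space_matrix (F : wclass R) (k : kind) (M : R -> nat -> R) :
    lcs R (wc_dom F) :=
  proj_lim (fun j : wc_idx F =>
    step_lim k (fun lh : {posnum R} * {posnum R} =>
      seminormed (@wc_base _ F)
        (wc_norm j (fun p => lh.2%:num ^+ p * M lh.1%:num p)))).

Definition space_weight (F : wclass R) (k : kind) (s : R -> \bar R) :
    lcs R (wc_dom F) :=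
  proj_lim (fun j : wc_idx F =>
    step_lim k (fun l : {posnum R} =>
      seminormed (@wc_base _ F) (wc_norm j (wmatrixR (fine \o s) l%:num)))).

(* A function on a subset of a type is represented by its extension by 0. The
   supremum of the empty set is -oo, which behaves like 0 here since the values
   of the seminorms are only used as left-hand sides of strict inequalities. *)

Definition cabs (z : Cx R) : R := complex.Re `|z|.

Definition partial d (i : 'I_d) (f : 'rV[R]_d -> Cx R) (x : 'rV[R]_d) : Cx R :=
  Complex ('D_(delta_mx 0 i) (fun y => complex.Re (f y)) x)
          ('D_(delta_mx 0 i) (fun y => complex.Im (f y)) x).

Definition partials d (s : seq 'I_d) (f : 'rV[R]_d -> Cx R) :=
  foldr (@partial d) f s.

Definition mpartial d (b : 'I_d -> nat) (f : 'rV[R]_d -> Cx R) :=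
  partials (flatten [seq nseq (b i) i | i <- enum 'I_d]) f.

Definition mdeg d (b : 'I_d -> nat) : nat := (\sum_(i < d) b i)%N.

Definition smooth_on d (U : set 'rV[R]_d) : set ('rV[R]_d -> Cx R) :=
  [set f | (forall x, ~ U x -> f x = 0) /\
    forall (s : seq 'I_d) x, U x ->
      [/\ {for x, continuous (fun y => complex.Re (partials s f y))},
          {for x, continuous (fun y => complex.Im (partials s f y))}
        & forall i : 'I_d,
          derivable (fun y => complex.Re (partials s f y)) x (delta_mx 0 i) /\
          derivable (fun y => complex.Im (partials s f y)) x (delta_mx 0 i)]].

Definition smooth_norm d (K : set 'rV[R]_d) (a : nat -> R)
    (f : 'rV[R]_d -> Cx R) : \bar R :=
  ereal_sup [set (cabs (mpartial xb.2 f xb.1) / a (mdeg xb.2))%:E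
            | xb in [set xb : 'rV[R]_d * ('I_d -> nat) | K xb.1]].

Definition classE d (U : set 'rV[R]_d) : wclass R :=
  @WClass R 'rV[R]_d {K : set 'rV[R]_d | compact K /\ K `<=` U}
    (smooth_on U) (fun K => smooth_norm (sval K)).

Definition classB d (U : set 'rV[R]_d) : wclass R :=
  @WClass R 'rV[R]_d unit (smooth_on U) (fun _ => smooth_norm U).

(* The point (r, theta), r > 0, of the Riemann surface of the logarithm is the
   one with modulus r and argument theta; [surf_proj] is the projection onto the
   punctured plane, which is a local chart at every point. *)
Definition surf_proj (z : R * R) : Cx R :=
  Complex (z.1 * cos z.2) (z.1 * sin z.2).

Definition sector (a b : R) : set (R * R) :=
  [set z | 0 < z.1 /\ a < z.2 < b].

Definition surf_quot (f : R * R -> Cx R) (z w : R * R) : Cx R :=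
  (f w - f z) / (surf_proj w - surf_proj z).

Definition surf_deriv (f : R * R -> Cx R) (z : R * R) : Cx R :=
  lim (surf_quot f z w @[w --> z^']).

Definition holomorphic_on (S : set (R * R)) : set (R * R -> Cx R) :=
  [set f | (forall z, ~ S z -> f z = 0) /\
           forall z, S z -> cvg (surf_quot f z w @[w --> z^'])].

Definition classA (S : set (R * R)) : wclass R :=
  @WClass R (R * R) unit (holomorphic_on S) (fun _ a f =>
    ereal_sup [set (cabs (iter zp.2 surf_deriv f zp.1) / a zp.2)%:E
              | zp in [set zp : (R * R) * nat | S zp.1]]).

Definition deriv1 (f : R -> Cx R) (x : R) : Cx R :=
  Complex (derive1 (fun y => complex.Re (f y)) x)
          (derive1 (fun y => complex.Im (f y)) x).

Definition smooth1 : set (R -> Cx R) :=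
  [set f | forall j x,
    derivable (fun y => complex.Re (iter j deriv1 f y)) x 1 /\
    derivable (fun y => complex.Im (iter j deriv1 f y)) x 1].

Definition classS : wclass R :=
  @WClass R R unit smooth1 (fun _ a f =>
    ereal_sup [set ((1 + `|xjk.1|) ^+ xjk.2.2 *
                    cabs (iter xjk.2.1 deriv1 f xjk.1) /
                    a (xjk.2.1 + xjk.2.2)%N)%:E
              | xjk in [set: R * (nat * nat)]]).

Definition classLambda : wclass R :=
  @WClass R nat unit setT (fun _ a c =>
    ereal_sup [set (cabs (c p) / a p)%:E | p in [set: nat]]).

(* A formal power series is given by its sequence of coefficients, so that this
   class coincides with the previous one. *)
Definition classF : wclass R := classLambda.

Inductive std_class : wclass R -> Prop :=
| std_E d (U : set 'rV[R]_d) :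
    (0 < d)%N -> open U -> U !=set0 -> std_class (classE U)
| std_B d (U : set 'rV[R]_d) :
    (0 < d)%N -> open U -> U !=set0 -> std_class (classB U)
| std_A (a b : R) : a < b -> std_class (classA (sector a b))
| std_S : std_class classS
| std_Lambda : std_class classLambda
| std_F : std_class classF.

End WeightedSpaces.

(* Main.v *)
(* With phi y = w (exp y), let g y be the supremum over u of
   phi u - exp ((u - y) / alpha), that is, the conjugate of w with id^(1/alpha)
   in the logarithmic variable. The exponent b > alpha of the sequence W^(l0) says
   that the slope of phi grows at most like exp (y / b); hence
   g (y + d) <= A g y + B for every d, so that g absorbs dilations, and with them
   geometric factors in its weight matrix and multiplicative constants in front
   of the Gevrey weight. This makes the five weight functions equivalent. For
   the matrix, the Young conjugate of g at x is
   phi^* x - alpha x ln x + O(x): the upper bound holds for every weight, and the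
   lower one again uses that exp (s / alpha) beats s exp (s / b). *)

Require Import Defs.
From HB Require Import structures.
From mathcomp Require Import all_boot all_order all_algebra.
From mathcomp Require Import complex ring lra.
From mathcomp Require Import all_classical all_reals all_analysis.

Set Implicit Arguments.
Unset Strict Implicit.
Unset Printing Implicit Defensive.

Import Order.TTheory GRing.Theory Num.Theory.
Import numFieldNormedType.Exports.

Local Open Scope classical_set_scope.
Local Open Scope ring_scope.

(** * Exponential inequalities and bounds for [ln p!] *)

Section Elementary.
Context {R : realType}.
Implicit Types (A E a b c s t x y : R) (p : nat).

(** On the shape of the whole argument. The growth index is assumed for one sequence only, whereas
    the conclusion concerns [W^(l)] for every [l]. The gap closes because all these sequences sample
    the same conjugate [psi]: the exponent is first turned into a growth bound for [phi] alone, in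
    which the sampling step [l0] survives only in constants. Since [phi] need not be differentiable,
    slopes are subgradients throughout. All the spaces are compared with the one built from [g]. If
    [h <= A g + B], conjugation turns [A] into the change of index from [l] to [A l] and [B] into a
    constant factor of the seminorm. As [l] to [A l] is a bijection of the positive reals, one such
    estimate serves both the Roumieu and the Beurling case. The quotient matrix has no such
    bijection of indices: there the two cases need separate choices, and the delicate one is the
    Beurling case, where a small [l] must be found after the constants. *)

Lemma sqr_half_le_expR s : 0 <= s -> (s / 2) ^+ 2 <= expR s.
Proof.
move=> s0; have h : s / 2 <= expR (s / 2).
  by have := expR_ge1Dx (s / 2); lra.
have -> : expR s = expR (s / 2) * expR (s / 2).
  by rewrite -expRD; congr expR; lra.
by rewrite expr2; apply: ler_pM => //; lra.
Qed.

Lemma mul_expR_le_expR a b A : 0 < a -> a < b -> 0 <= A ->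
  exists2 s0 : R, 1 <= s0 &
    forall s, s0 <= s -> A * s * expR (s / b) <= expR (s / a).
Proof.
move=> a0 ab A0; pose d := a^-1 - b^-1.
have b0 : 0 < b by apply: lt_trans ab.
have d0 : 0 < d by rewrite subr_gt0 ltf_pV2.
(* As [exp (d s)] is at least [(d s / 2)^2], it suffices that [A s <= d^2 s^2 / 4]. *)
exists (Num.max 1 (4 * A / d ^+ 2)); first by rewrite le_max lexx.
move=> s; rewrite ge_max => /andP[s1 sA].
have s0 : 0 < s by lra.
have -> : s / a = s / b + d * s by rewrite /d; lra.
rewrite expRD [leRHS]mulrC; apply: ler_wpM2r; first exact: expR_ge0.
apply: le_trans (sqr_half_le_expR _); last by rewrite mulr_ge0 ?ltW.
move: sA; rewrite ler_pdivrMr ?exprn_gt0// => sA.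
have -> : (d * s / 2) ^+ 2 = s * d ^+ 2 / 4 * s by field.
by rewrite ler_pM2r//; lra.
Qed.

Lemma mul_expR_bounded a b A : 0 < a -> a < b -> 0 <= A ->
  exists2 H : R, 0 <= H &
    forall s, 0 <= s -> A * s * expR (s / b) <= expR (s / a) + H.
Proof.
move=> a0 ab A0; have [s0 s01 hs] := mul_expR_le_expR a0 ab A0.
have b0 : 0 < b by apply: lt_trans ab.
exists (A * s0 * expR (s0 / b)).
  by rewrite !mulr_ge0 ?expR_ge0//; lra.
move=> s s_ge0; have [/hs|/ltW ss0] := leP s0 s.
  have := mulr_ge0 (mulr_ge0 A0 (le_trans ler01 s01)) (expR_ge0 (s0 / b)).
  lra.
apply: ler_wpDl; first exact: expR_ge0.
apply: ler_pM; rewrite ?mulr_ge0 ?expR_ge0//.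
  by apply: ler_wpM2l.
by rewrite ler_expR ler_pM2r ?invr_gt0.
Qed.

Lemma mul_expR_dominated a b A E : 0 < a -> a < b -> 0 <= A -> 0 <= E ->
  exists2 s, 0 <= s & E * (1 + A * s * expR (s / b)) <= expR (s / a).
Proof.
move=> a0 ab A0 E0.
have EA0 : 0 <= E * (1 + A) by rewrite mulr_ge0//; lra.
have [s s1 /(_ s (lexx _)) hs] := mul_expR_le_expR a0 ab EA0.
have b0 : 0 < b by apply: lt_trans ab.
exists s; first lra.
(* This absorbs the summand 1: with [X = s exp (s / b)], [1 + A X <= (1 + A) X]. *)
have : 1 <= s * expR (s / b).
  rewrite -[leLHS]mulr1; apply: ler_pM; rewrite ?ler01//.
  by rewrite -expR0 ler_expR divr_ge0//; lra.
move=> h; apply: le_trans hs.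
have -> : E * (1 + A) * s * expR (s / b) = E * ((1 + A) * (s * expR (s / b))).
  by ring.
by apply: ler_wpM2l => //; rewrite -mulrA; set X := s * expR _ in h *; lra.
Qed.

Lemma expn_le_fact_expR p t : 0 <= t -> t ^+ p / p`!%:R <= expR t.
Proof.
case: p => [|p] t0; first by rewrite fact0 expr0 divr1 -expR0 ler_expR.
by have := expR_ge1Dxn p t0; lra.
Qed.

(** One term of the exponential series at [exp t] is at most its sum; take logarithms. For
    [t = ln p] this is the lower Stirling bound, but a free [t] makes it a Young inequality. *)
Lemma ln_fact_ge p t : p%:R * t - expR t <= ln p`!%:R.
Proof.
have fp : 0 < p`!%:R :> R by rewrite ltr0n fact_gt0.
have := expn_le_fact_expR p (expR_ge0 t).
rewrite ler_pdivrMr// -expRM_natl => h.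
have : p%:R * t <= ln (expR (expR t) * p`!%:R).
  by rewrite -[leLHS]expRK ler_ln ?posrE ?mulr_gt0 ?expR_gt0.
rewrite lnM ?posrE ?expR_gt0// expRK; lra.
Qed.

Lemma ln_fact_le p : ln p`!%:R <= p%:R * ln p%:R :> R.
Proof.
case: p => [|p]; first by rewrite fact0 ln1 mul0r.
rewrite mulrC mulr_natr -lnXn ?ltr0n//.
rewrite ler_ln ?posrE ?exprn_gt0 ?ltr0n ?fact_gt0//.
rewrite -natrX ler_nat; elim: p.+1 => // n IH.
rewrite factS expnS leq_mul//; apply: leq_trans IH _.
by case: n => // n; rewrite leq_exp2r.
Qed.

End Elementary.

(** * Subgradients of convex functions on the line *)

Section Convex.
Context {R : realType}.
Implicit Types (phi psi : R -> R) (x y z : R).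

Definition subgradient phi z x := forall y, phi z + x * (y - z) <= phi y.

(** The left derivative works: it is the supremum of the difference quotients to the left of [z],
    which convexity bounds by those to the right and monotonicity makes nonnegative. *)
Lemma subgradient_exists phi z :
    convex_function setT (phi : R^o -> R^o) ->
    {homo phi : x y / x <= y} ->
  exists2 x, 0 <= x & subgradient phi z x.
Proof.
move=> cvx nd.
pose S := [set (phi z - phi y) / (z - y) | y in [set y | y < z]].
have slopes y y' : y < z -> z < y' ->
    (phi z - phi y) / (z - y) <= (phi y' - phi z) / (y' - z).
  move=> yz zy'.
  have yy' : 0 < y' - y by lra.
  have t01 : 0 <= (y' - z) / (y' - y) <= 1.
    by rewrite divr_ge0 ?ler_pdivrMr//=; lra.
  have := cvx (Itv01 (proj1 (andP t01)) (proj2 (andP t01))) y y'.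
  rewrite !in_setE => /(_ I I).
  have -> : conv (Itv01 (proj1 (andP t01)) (proj2 (andP t01)))
      (y : convex_lmodType R^o) y' = z.
    by rewrite [LHS]convRE /= /unstable.onem; field; lra.
  rewrite convRE /= /unstable.onem.
  have -> : (y' - z) / (y' - y) * phi y + (1 - (y' - z) / (y' - y)) * phi y' =
      ((y' - z) * phi y + (z - y) * phi y') / (y' - y) by field; lra.
  rewrite ler_pdivlMr// => h.
  rewrite ler_pdivrMr ?subr_gt0// mulrAC ler_pdivlMr ?subr_gt0//; nra.
have S0 : S !=set0.
  by exists ((phi z - phi (z - 1)) / (z - (z - 1))), (z - 1) => //=; lra.
have Sub : has_ubound S.
  exists ((phi (z + 1) - phi z) / (z + 1 - z)) => _ [y /= yz <-].
  by apply: slopes => //; lra.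
exists (sup S).
  apply: le_trans (ub_le_sup Sub _); last by exists (z - 1) => //=; lra.
  by rewrite divr_ge0 ?subr_ge0 ?nd//; lra.
move=> y; have [yz|zy|->] := ltgtP y z; last by rewrite subrr mulr0 addr0.
  have : (phi z - phi y) / (z - y) <= sup S by apply: ub_le_sup => //; exists y.
  rewrite ler_pdivrMr ?subr_gt0//; lra.
have : sup S <= (phi y - phi z) / (y - z).
  by apply: ge_sup => // _ [y' /= y'z <-]; apply: slopes.
rewrite ler_pdivlMr ?subr_gt0//; lra.
Qed.

End Convex.

(** * Growth of a weight function *)

(* In the variable t = exp y, this is the conjugate of w with id^(1/alpha) when
   phi y = w (exp y). *)
Definition root_conj {R : realType} (alpha : R) (phi : R -> R) (y : R) : R :=
  sup [set phi u - expR ((u - y) / alpha) | u in [set: R]].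

Section Growth.
Context {R : realType} (w : R -> R) (alpha : R).
Context (w_weight : weight0 w) (alpha_gt0 : 0 < alpha).
Context (w_small : littleo_pinfty w (fun t : R => t `^ alpha^-1)).

Let phi y := w (expR y).
Let psi := phi_star w.
Let g := root_conj alpha phi.

Lemma logweight_ge0 y : 0 <= phi y.
Proof. by apply: (weight0_ge0 w_weight); apply: expR_ge0. Qed.

Lemma logweight_nd : {homo phi : x y / x <= y}.
Proof.
by move=> x y xy; apply: (weight0_nd w_weight); rewrite ?expR_ge0 ?ler_expR.
Qed.

Lemma logweight_eq0 y : y <= 0 -> phi y = 0.
Proof.
move=> y0; apply: (weight0_eq0 w_weight).
by rewrite expR_ge0 -expR0 ler_expR.
Qed.

Lemma logweight_log (e : R) : 0 < e ->
  exists2 C : R, 0 <= C & forall y, y <= e * phi y + C.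
Proof.
move=> e0; have [M [_ hM]] := weight0_log w_weight e0.
exists `|M| => // y.
have := logweight_ge0 y; set p := phi y => p0.
have [My|] := ltP M (expR y).
  move: (hM _ My); rewrite expRK -/(phi y) -/p (ger0_norm p0).
  by have := ler_norm y; have := normr_ge0 M; lra.
by have := expR_ge1Dx y; have := ler_norm M; have := mulr_ge0 (ltW e0) p0; lra.
Qed.

Lemma logweight_small (e : R) : 0 < e ->
  exists2 C : R, 0 <= C & forall u, phi u <= e * expR (u / alpha) + C.
Proof.
move=> e0; have [M [_ hM]] := w_small e0.
have wM0 : 0 <= w `|M| by apply: (weight0_ge0 w_weight).
exists (w `|M|) => // u.
have E0 := mulr_ge0 (ltW e0) (expR_ge0 (u / alpha)).
have [Mu|uM] := ltP M (expR u).
  move: (hM _ Mu); rewrite ger0_norm ?(logweight_ge0 u)// -/(phi u).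
  rewrite ger0_norm ?powR_ge0// /powR gt_eqF ?expR_gt0// expRK [_^-1 * u]mulrC.
  by lra.
have : phi u <= w `|M|.
  apply: (weight0_nd w_weight); first exact: expR_ge0.
  exact: le_trans uM (ler_norm _).
lra.
Qed.

Lemma logweight_subgradient (z : R) : exists2 x, 0 <= x & subgradient phi z x.
Proof. exact: subgradient_exists (weight0_convex w_weight) logweight_nd. Qed.

Lemma phi_star_ubound (x : R) : 0 <= x ->
  has_ubound [set x * y - w (expR y) | y in `[0, +oo[].
Proof.
(* With this [e], [x e <= 1], so that [x y - phi y <= x C]. *)
move=> x0; have e0 : 0 < (x + 1)^-1 by rewrite invr_gt0; lra.
have [C C0 hC] := logweight_log e0.
exists (x * C) => _ [y _ <-].
have := ler_wpM2l x0 (hC y); rewrite mulrDr mulrA -/(phi y).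
have : x / (x + 1) * phi y <= phi y.
  rewrite -[leRHS]mul1r ler_wpM2r ?logweight_ge0// ler_pdivrMr; lra.
lra.
Qed.

(** For negative [y] the left side is [x y <= 0], since [phi] vanishes there; hence restricting the
    supremum to [y >= 0] loses nothing. *)
Lemma phi_star_ge (x y : R) : 0 <= x -> x * y - phi y <= psi x.
Proof.
move=> x0; have h z : 0 <= z -> x * z - phi z <= psi x.
  move=> z0; apply: ub_le_sup; first exact: phi_star_ubound.
  by exists z => //=; rewrite in_itv/= z0.
have [/h//|y0] := leP 0 y.
apply: le_trans (h 0 (lexx _)).
rewrite !logweight_eq0 ?lexx ?(ltW y0)//.
have := ler_wpM2l x0 (ltW y0); lra.
Qed.

Lemma phi_star_le (x B : R) :
  (forall y, 0 <= y -> x * y - phi y <= B) -> psi x <= B.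
Proof.
move=> h; apply: ge_sup.
  by exists (x * 0 - phi 0); exists 0 => //=; rewrite in_itv/= lexx.
by move=> _ [y /= + <-]; rewrite in_itv/= andbT; apply: h.
Qed.

Lemma phi_star_approx (x : R) : 0 <= x ->
  exists2 z, 0 <= z & psi x - 1 < x * z - phi z.
Proof.
move=> x0; have hS : has_sup [set x * y - w (expR y) | y in `[0, +oo[].
  split; last exact: phi_star_ubound.
  by exists (x * 0 - phi 0); exists 0 => //=; rewrite in_itv/= lexx.
have [_ [z /= + <-] h] := sup_adherent ltr01 hS.
by rewrite in_itv/= andbT => z0; exists z.
Qed.

Lemma phi_star_nd (x x' : R) : 0 <= x -> x <= x' -> psi x <= psi x'.
Proof.
move=> x0 xx'; apply: phi_star_le => y y0.
apply: le_trans (phi_star_ge y (le_trans x0 xx')).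
by rewrite lerB// ler_wpM2r.
Qed.

Lemma phi_star0 : psi 0 = 0.
Proof.
apply/eqP; rewrite eq_le; apply/andP; split.
  by apply: phi_star_le => y _; have := logweight_ge0 y; lra.
by have := phi_star_ge 0 (lexx 0); rewrite logweight_eq0// mul0r subr0.
Qed.

(** Conjugation exchanges points and slopes: beyond [x], [psi] grows at rate at least [z]. A
    competitor [y >= z] for [psi a] is kept for [psi c]; one below [z] is replaced by [z]. *)
Lemma phi_star_slope_ge (z x a c : R) : subgradient phi z x -> 0 <= x ->
  x <= a -> a <= c -> psi a + (c - a) * z <= psi c.
Proof.
move=> xz x0 xa ac; rewrite -lerBrDr; apply: phi_star_le => y y0.
have c0 : 0 <= c by lra.
have [zy|yz] := leP z y.
  have := phi_star_ge y c0.
  have : 0 <= (c - a) * (y - z) by rewrite mulr_ge0//; lra.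
  lra.
have := phi_star_ge z c0; have := xz y.
have : 0 <= (a - x) * (z - y) by rewrite mulr_ge0//; lra.
lra.
Qed.

Lemma phi_star_slope_le (z x a c : R) : subgradient phi z x -> 0 <= a ->
  a <= c -> c <= x -> psi c <= psi a + (c - a) * z.
Proof.
move=> xz a0 ac cx; apply: phi_star_le => y y0.
have [yz|zy] := leP y z.
  have := phi_star_ge y a0.
  have : 0 <= (c - a) * (z - y) by rewrite mulr_ge0//; lra.
  lra.
have := phi_star_ge z a0; have := xz y.
have : 0 <= (x - c) * (y - z) by rewrite mulr_ge0//; lra.
lra.
Qed.

(** The set is bounded because [w] is small against [t^(1/alpha)]: with the constant
    [exp (- y / alpha)], the resulting bound for [phi] is the subtracted exponential plus a
    constant. *)
Lemma root_conj_ge (u y : R) : phi u - expR ((u - y) / alpha) <= g y.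
Proof.
apply: ub_le_sup; last by exists u.
have [C C0 hC] := logweight_small (expR_gt0 (- y / alpha)).
exists C => _ [v _ <-]; have := hC v; rewrite -expRD -mulrDl (addrC (- y)).
by lra.
Qed.

Lemma root_conj_le (y B : R) :
  (forall u, phi u - expR ((u - y) / alpha) <= B) -> g y <= B.
Proof.
move=> h; apply: ge_sup; first by exists (phi y - expR ((y - y) / alpha)), y.
by move=> _ [u _ <-].
Qed.

Lemma root_conj_ge0 (y : R) : 0 <= g y.
Proof.
rewrite leNgt; apply/negP => g0.
have h : 0 < - (g y / 2) by lra.
(* Here [u] is chosen so that the exponential equals [- g y / 2], which would give
   [g y >= g y / 2]. *)
have := root_conj_ge (y + alpha * ln (- (g y / 2))) y.
rewrite addrAC subrr add0r mulrAC mulfV ?gt_eqF// mul1r lnK//.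
have := logweight_ge0 (y + alpha * ln (- (g y / 2))).
by rewrite -/(phi _); lra.
Qed.

Lemma root_conj_log (e : R) : 0 < e ->
  exists2 C : R, 0 <= C & forall y, y <= e * g y + C.
Proof.
move=> e0; have [C C0 hC] := logweight_log e0.
exists (C + e) => [|y]; first lra.
have := root_conj_ge y y; rewrite subrr mul0r expR0 => h.
have : e * phi y <= e * (g y + 1) by rewrite ler_wpM2l ?(ltW e0)//; lra.
by have := hC y; rewrite -/(phi y); lra.
Qed.

(** For [p > 0], test both [g] and [psi] at [u = y + 1 + alpha ln p]. The exponential is then [l p],
    paid for by the summand 1 of [u], and [alpha p ln p] dominates [alpha ln p!]. *)
Lemma root_conj_upper (l : R) p (y : R) : 0 < l ->
  p%:R * y - psi (l * p%:R) / l + alpha * ln p`!%:R <=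
    g (y + (1 - alpha * ln l)) / l.
Proof.
move=> l0; case: p => [|p].
  rewrite mulr0 phi_star0 fact0 ln1 !mul0r mulr0 subr0 addr0.
  by rewrite divr_ge0 ?root_conj_ge0// ltW.
move: p.+1 (ltn0Sn p) => {}p p0; set y' := y + _.
have pR : 0 < p%:R :> R by rewrite ltr0n.
have x0 : 0 < l * p%:R by rewrite mulr_gt0.
rewrite ler_pdivlMr//.
have := root_conj_ge (alpha * ln (l * p%:R) + y') y'.
rewrite addrK mulrAC mulfV ?gt_eqF// mul1r lnK//.
have := phi_star_ge (alpha * ln (l * p%:R) + y') (ltW x0).
rewrite -/psi lnM ?posrE//.
have : alpha * ln p`!%:R * l <= alpha * (p%:R * ln p%:R) * l.
  by rewrite ler_pM2r// ler_pM2l// ln_fact_le.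
have -> : (p%:R * y - psi (l * p%:R) / l + alpha * ln p`!%:R) * l =
  l * p%:R * y - psi (l * p%:R) + alpha * ln p`!%:R * l by field; lra.
rewrite /y'; lra.
Qed.

(* x is the slope of phi at u and l p the largest multiple of l below it. *)
Lemma slope_trunc (l u : R) : 0 < l -> exists (x : R) (p : nat),
  phi u <= x * u - psi (l * p%:R) /\
  forall v, x * v <= l * p%:R * v + l * Num.max v 0.
Proof.
move=> l0; have [x x0 xu] := logweight_subgradient u.
have /truncn_itv := divr_ge0 x0 (ltW l0); set p := Num.trunc _.
rewrite ler_pdivlMr// ltr_pdivrMr// => /andP[px xp].
rewrite -natr1 in xp; exists x, p; split=> [|v]; last first.
  have [v0|v0] := leP 0 v.
    by have := ler_wpM2r v0 (ltW xp); lra.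
  by have := ler_wnM2r (ltW v0) px; lra.
have : psi x <= x * u - phi u.
  by apply: phi_star_le => z _; have := xu z; lra.
have : psi (l * p%:R) <= psi x.
  by apply: phi_star_nd; rewrite ?mulr_ge0 ?ler0n ?(ltW l0)//; lra.
lra.
Qed.

Lemma assoc_le_logweight (l u : R) p : 0 < l ->
  p%:R * u - psi (l * p%:R) / l <= phi u / l.
Proof.
move=> l0; rewrite ler_pdivlMr//.
have := phi_star_ge u (mulr_ge0 (ltW l0) (ler0n R p)).
have -> : (p%:R * u - psi (l * p%:R) / l) * l = l * p%:R * u - psi (l * p%:R).
  by field; lra.
rewrite -/psi; lra.
Qed.

(** Allowing only multiples of [l] as slopes loses at most [l max(u, 0)], which is absorbed as half
    of [phi u] plus a constant; hence the factor 2. The number [B] stands for the associated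
    function at [exp u]. *)
Lemma logweight_le_assoc (l : R) : 0 < l ->
  exists2 C : R, 0 <= C & forall u B,
    (forall p, p%:R * u - psi (l * p%:R) / l <= B) -> phi u <= 2 * l * B + C.
Proof.
move=> l0; have e0 : 0 < (2 * l)^-1 by rewrite invr_gt0 mulr_gt0.
have [C C0 hC] := logweight_log e0.
exists (2 * l * C) => [|u B hB]; first by rewrite !mulr_ge0// ltW.
have [x [p [hp /(_ u) xu]]] := slope_trunc u l0.
have := ler_wpM2l (ltW l0) (hB p).
have -> : l * (p%:R * u - psi (l * p%:R) / l) = l * p%:R * u - psi (l * p%:R).
  by field; lra.
have : l * Num.max u 0 <= l * ((2 * l)^-1 * phi u + C).
  rewrite ler_pM2l// ge_max hC/= addr_ge0// mulr_ge0 ?logweight_ge0//.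
  exact: ltW.
have -> : l * ((2 * l)^-1 * phi u + C) = phi u / 2 + l * C by field; lra.
lra.
Qed.

(** Half of the exponential in [g] pays, through [ln_fact_ge], for the Gevrey term; the other half
    pays for the truncation error [k max(t, 0)]. The error [l max(y, 0)] is absorbed into
    [g y / 2]. *)
Lemma root_conj_le_assoc (l : R) : 0 < l ->
  exists c A C : R, [/\ 0 < A, 0 <= C & forall y B,
    (forall p, p%:R * (y + c) - psi (l * p%:R) / l + alpha * ln p`!%:R <= B) ->
    g y <= A * B + C].
Proof.
move=> l0; pose k := l * alpha.
have a0 := alpha_gt0.
have k0 : 0 < k by rewrite mulr_gt0.
have e0 : 0 < (2 * l)^-1 by rewrite invr_gt0 mulr_gt0.
have [C C0 hC] := root_conj_log e0.
exists (alpha * ln (2 * k)), (2 * l), (2 * (l * C + 2 * k ^+ 2)).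
split; first lra.
  by rewrite mulr_ge0// addr_ge0// mulr_ge0// ?exprn_ge0 ?ltW.
move=> y B hB.
suff : g y <= l * B + l * Num.max y 0 + 2 * k ^+ 2.
  have : l * Num.max y 0 <= l * ((2 * l)^-1 * g y + C).
    rewrite ler_pM2l// ge_max hC/= addr_ge0// mulr_ge0 ?root_conj_ge0//.
    exact: ltW.
  have -> : l * ((2 * l)^-1 * g y + C) = g y / 2 + l * C by field; lra.
  lra.
apply: root_conj_le => u.
have [x [p [phiu xmax]]] := slope_trunc u l0.
pose t := (u - y) / alpha.
have ut : u = y + alpha * t by rewrite /t; field; lra.
have := hB p; rewrite -/t.
(* After multiplication by [k] the exponential becomes [exp t / 2]; the price is the translation
   [c = alpha ln (2 k)]. *)
have := ln_fact_ge p (t - ln (2 * k)).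
rewrite expRB lnK ?posrE ?mulr_gt0// => hf.
have {hf} : k * (p%:R * (t - ln (2 * k))) - expR t / 2 <= k * ln p`!%:R.
  have -> : expR t / 2 = k * (expR t / (2 * k)) by field; lra.
  by rewrite -mulrBr ler_pM2l.
have ht : k * Num.max t 0 - expR t / 2 <= 2 * k ^+ 2.
  have [t0|t0] := leP 0 t.
    have := sqr_half_le_expR t0; have := sqr_ge0 (t - 4 * k).
    by rewrite !expr2; lra.
  by have := sqr_ge0 k; have := expR_ge0 t; lra.
move=> hf hp.
have := ler_wpM2l (ltW l0) hp.
have -> : l * (p%:R * (y + alpha * ln (2 * k)) - psi (l * p%:R) / l +
    alpha * ln p`!%:R) = l * (p%:R * (y + alpha * ln (2 * k))) -
    psi (l * p%:R) + l * (alpha * ln p`!%:R) by field; lra.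
have := xmax y; have := ler_wpM2l (ltW a0) (xmax t).
move: hf ht phiu; rewrite -/t ut /k; lra.
Qed.

(** * Consequences of an exponent of the growth index *)

Section Thilliez.
Context (b l0 : R) (b_gt0 : 0 < b) (l0_gt0 : 0 < l0).
Context (wb : thilliez_exponent (wmatrix w l0) b).

(** Both the logarithm of the quotient [mu_p] and the mean slope of [psi] over
    [[l0 (p - 1), l0 p]]. *)
Let m p := (psi (l0 * p%:R) - psi (l0 * p.-1%:R)) / l0.

Lemma thilliez_log_quotient : exists2 k : R, 0 <= k &
  forall p q, (1 <= p)%N -> (p <= q)%N ->
    m p - b * ln p%:R <= m q - b * ln q%:R + k.
Proof.
have [a [lam [a1 lam0 lam_nd hlam]]] := wb.
have a0 : 0 < a by lra.
exists (ln (a * a)); first by rewrite ln_ge0// -[1]mulr1 ler_pM.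
have mE p : (1 <= p)%N -> quotient_seq (wmatrix w l0) p * p%:R `^ (- b) =
    expR (m p - b * ln p%:R).
  move=> p1; rewrite /quotient_seq /wmatrix /weight_seq -expRB.
  rewrite /powR pnatr_eq0 eqn0Ngt p1 -expRD; congr expR.
  by rewrite /m /psi; ring.
move=> p q p1 pq; have q1 := leq_trans p1 pq.
have /andP[_] := hlam _ p1; have /andP[+ _] := hlam _ q1.
rewrite !mE// ler_pdivrMl// => hq hp.
rewrite -ler_expR [leRHS]expRD lnK ?posrE ?mulr_gt0//.
apply: (le_trans hp); rewrite [leRHS]mulrC -mulrA ler_wpM2l ?(ltW a0)//.
exact: le_trans (lam_nd _ _ p1 pq) hq.
Qed.

(* The quotients of the sequence sample the inverse of the slope of phi, at
   scale l0, so an exponent b of the sequence bounds the growth of the slope. *)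
Lemma slope_growth : exists2 A : R, 0 <= A &
  forall z z' x x', z <= z' -> 0 <= x -> 0 <= x' ->
    subgradient phi z x -> subgradient phi z' x' ->
    x' <= A * (x + 1) * expR ((z' - z) / b).
Proof.
have [k k0 hk] := thilliez_log_quotient.
exists (2 * expR (k / b) * (1 + 2 * l0)).
  by rewrite mulr_ge0 ?mulr_ge0 ?expR_ge0// addr_ge0// mulr_ge0// ltW.
move=> z z' x x' zz' x0 x'0 xz xz'.
have b0 := b_gt0; have l00 := l0_gt0.
have E1 : 1 <= expR ((z' - z) / b) by rewrite -expR0 ler_expR divr_ge0//; lra.
have K1 : 1 <= expR (k / b) by rewrite -expR0 ler_expR divr_ge0//; lra.
have xl : x + 2 * l0 <= (1 + 2 * l0) * (x + 1).
  by have := mulr_ge0 x0 (ltW l0_gt0); lra.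
suff : x' <= 2 * (expR (k / b) * expR ((z' - z) / b)) * (x + 2 * l0).
  move/le_trans; apply.
  have -> : 2 * expR (k / b) * (1 + 2 * l0) * (x + 1) * expR ((z' - z) / b) =
      2 * (expR (k / b) * expR ((z' - z) / b)) * ((1 + 2 * l0) * (x + 1)).
    by ring.
  by rewrite ler_wpM2l// !mulr_ge0 ?expR_ge0.
have /truncn_itv := divr_ge0 x0 (ltW l0_gt0); set n := Num.trunc _.
have /truncn_itv := divr_ge0 x'0 (ltW l0_gt0); set q := Num.trunc _.
rewrite !ler_pdivlMr// !ltr_pdivrMr// -[n.+1%:R]natr1 -[q.+1%:R]natr1.
move=> /andP[qx' x'q] /andP[nx xn].
have KE1 : 1 <= expR (k / b) * expR ((z' - z) / b).
  by rewrite -[leLHS]mulr1 ler_pM.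
(* The interval sampled by [m n.+2] lies to the right of [x], the one sampled by [m q] to the left
   of [x']; so [z <= m n.+2] and [m q <= z'], and these are comparable if [n.+2 <= q]. Otherwise
   [x'] is below [x + 2 l0] already. *)
have [pq|qp] := leqP n.+2 q; last first.
  have : q%:R <= n%:R + 1 :> R by rewrite natr1 ler_nat.
  move=> qn; have : (q%:R + 1) * l0 <= (n%:R + 1 + 1) * l0.
    by rewrite ler_pM2r//; lra.
  have : 1 * (x + 2 * l0) <=
      2 * (expR (k / b) * expR ((z' - z) / b)) * (x + 2 * l0).
    by rewrite ler_wpM2r//; lra.
  lra.
have q1 : (1 <= q)%N by apply: leq_trans pq.
have mp : z <= m n.+2.
  rewrite /m ler_pdivlMr// /= -[n.+2%:R]natr1.
  have := @phi_star_slope_ge z x (l0 * n.+1%:R) (l0 * (n.+1%:R + 1)) xz x0.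
  rewrite -natr1; have -> : x <= l0 * (n%:R + 1) by lra.
  by move=> /(_ isT); rewrite ler_pM2l//; lra.
have mq : m q <= z'.
  rewrite /m ler_pdivrMr//.
  have := @phi_star_slope_le z' x' (l0 * q.-1%:R) (l0 * q%:R) xz'.
  rewrite mulr_ge0 ?(ltW l0_gt0)// ler_pM2l// ler_nat leq_pred.
  have -> : l0 * q%:R <= x' by lra.
  move=> /(_ isT isT isT).
  have -> : q%:R = q.-1%:R + 1 :> R by rewrite natr1 prednK.
  lra.
have lnq : ln q%:R <= ln n.+2%:R + (k / b + (z' - z) / b).
  rewrite -(ler_pM2l b_gt0) mulrDr -mulrDl mulrCA mulfV ?gt_eqF// mulr1.
  have := hk _ _ (isT : (1 <= n.+2)%N) pq; lra.
have qn : q%:R <= n.+2%:R * (expR (k / b) * expR ((z' - z) / b)).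
  move: lnq; rewrite -ler_expR expRD [in expR (_ / b + _)]expRD.
  by rewrite !lnK ?posrE ?ltr0n.
have q1R : 1 <= q%:R :> R by rewrite ler1n.
set KE := expR (k / b) * _ in qn KE1 *.
have x'2q : x' <= 2 * q%:R * l0.
  apply: (le_trans (ltW x'q)); rewrite ler_pM2r//; lra.
apply: (le_trans x'2q).
have -> : 2 * KE * (x + 2 * l0) = 2 * (KE * (x / l0 + 2)) * l0.
  by field; lra.
rewrite ler_pM2r// ler_pM2l//.
apply: (le_trans qn); rewrite mulrC ler_wpM2l//; first lra.
by rewrite -addn2 natrD lerD2r ler_pdivlMr.
Qed.

Lemma growth_of_slope : exists2 A : R, 0 <= A &
  forall z s x, 0 <= s -> 0 <= x -> subgradient phi z x ->
    phi (z + s) <= phi z + A * (x + 1) * s * expR (s / b).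
Proof.
have [A A0 hA] := slope_growth; exists A => // z s x s0 x0 xz.
have [x' x'0 xz'] := logweight_subgradient (z + s).
have zs : z <= z + s by lra.
have := hA _ _ _ _ zs x0 x'0 xz xz'; rewrite (addrAC z) subrr add0r => h.
have := ler_wpM2r s0 h; have := xz' z; lra.
Qed.

(** The slope at [z - 1] is at most [phi z - phi (z - 1)], hence at most [phi z]; [slope_growth]
    over a unit step carries this bound to the slope at [z]. *)
Lemma growth : exists2 A : R, 0 <= A &
  forall z s, 0 <= s ->
    phi (z + s) <= phi z + A * (phi z + 1) * s * expR (s / b).
Proof.
have [A A0 hA] := slope_growth; have [B B0 hB] := growth_of_slope.
exists (B * (A * expR b^-1 + 1)).
  by rewrite mulr_ge0// addr_ge0// mulr_ge0// expR_ge0.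
move=> z s s0.
have [x x0 xz] := logweight_subgradient z.
have [y y0 yz] := logweight_subgradient (z - 1).
have zz : z - 1 <= z by lra.
have := hA _ _ _ _ zz y0 x0 yz xz.
have -> : (z - (z - 1)) / b = b^-1 by lra.
have yphi : y <= phi z.
  by have := yz z; have : 0 <= phi (z - 1) := logweight_ge0 _; lra.
have p0 : 0 <= phi z := logweight_ge0 z.
move=> xA; have {xA}xA : x + 1 <= (A * expR b^-1 + 1) * (phi z + 1).
  have : A * expR b^-1 * (y + 1) <= A * expR b^-1 * (phi z + 1).
    by rewrite ler_wpM2l ?mulr_ge0 ?expR_ge0//; lra.
  lra.
apply: le_trans (hB _ _ _ s0 x0 xz) _.
rewrite lerD2l -2![leLHS]mulrA -2![leRHS]mulrA.
have -> : B * (A * expR b^-1 + 1) * ((phi z + 1) * (s * expR (s / b))) =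
  B * ((A * expR b^-1 + 1) * (phi z + 1) * (s * expR (s / b))) by ring.
by rewrite ler_wpM2l// ler_wpM2r// mulr_ge0 ?expR_ge0.
Qed.

Context (alpha_lt_b : alpha < b).

(* Substituting u + s for u turns phi (u + s) <= K (phi u + 1) into a bound of
   g (y + d) by K g y as soon as K exp (d / alpha) <= exp (s / alpha), and K grows
   like s exp (s / b) with alpha < b. *)
Lemma root_conj_shift (d : R) : exists A B : R,
  [/\ 0 < A, 0 <= B & forall y, g (y + d) <= A * g y + B].
Proof.
have [A A0 hA] := growth.
have [s s0] :=
  mul_expR_dominated alpha_gt0 alpha_lt_b A0 (expR_ge0 (d / alpha)).
set K := 1 + A * s * expR (s / b) => hK.
have K1 : 0 <= A * s * expR (s / b) by rewrite !mulr_ge0 ?expR_ge0.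
exists K, K; rewrite /K; split; [lra|lra|rewrite -/K => y].
apply: root_conj_le => u.
have := hA (u - s) s s0; rewrite subrK => hu.
have : K * expR ((u - s - y) / alpha) <= expR ((u - (y + d)) / alpha).
  have -> : (u - (y + d)) / alpha = (u - s - y) / alpha + s / alpha - d / alpha.
    by field; rewrite gt_eqF.
  rewrite expRB expRD ler_pdivlMr ?expR_gt0// -mulrA mulrC.
  by rewrite -mulrA ler_wpM2l ?expR_ge0// mulrC.
have : K * (phi (u - s) - expR ((u - s - y) / alpha)) <= K * g y.
  by rewrite ler_wpM2l ?root_conj_ge// /K; lra.
move: hu; rewrite /K; lra.
Qed.

(* T stands for the associated function of the Gevrey sequence; multiplying it by
   a constant amounts to a shift in the logarithmic variable. *)
Lemma root_conj_equiv (h T : R -> R) (c D : R) :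
  0 < c -> 0 <= D ->
  (forall u, h u <= c * phi u + D) -> (forall u, phi u <= c * h u + D) ->
  (forall v, T v <= alpha * expR (v / alpha)) ->
  (forall v, alpha * (expR (v / alpha - 1) - 1) <= T v) ->
  exists A B : R, [/\ 0 < A, 0 <= B,
    forall u y, h u - T (u - y) <= A * g y + B
    & exists A' B' : R, [/\ 0 < A', 0 <= B' & forall y Q,
        (forall u, h u - T (u - y) <= Q) -> g y <= A' * Q + B']].
Proof.
move=> c0 D0 hphi phih Tle Tge.
have a0 := alpha_gt0.
(* The first shift [d] gives [c exp ((u - y - d) / alpha) = alpha exp ((u - y) / alpha - 1)], the
   lower bound of [T] up to a constant; the second gives [exp ((u - y + d) / alpha) = c alpha exp
   ((u - y) / alpha)], [c] times its upper bound. *)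
have [A1 [B1 [A10 B10 h1]]] := root_conj_shift (alpha * (1 + ln c - ln alpha)).
have [A2 [B2 [A20 B20 h2]]] := root_conj_shift (alpha * (ln c + ln alpha)).
exists (c * A1), (c * B1 + D + alpha); split; first exact: mulr_gt0.
- by rewrite !addr_ge0 ?mulr_ge0// ltW.
- move=> u y; pose d := alpha * (1 + ln c - ln alpha).
  have := Tge (u - y); have := hphi u.
  have := ler_wpM2l (ltW c0) (h1 y).
  have := ler_wpM2l (ltW c0) (root_conj_ge u (y + d)).
  have -> : (u - (y + d)) / alpha = (u - y) / alpha - 1 + ln alpha - ln c.
    by rewrite /d; field; rewrite gt_eqF.
  rewrite expRB expRD !lnK//.
  have -> : c * (phi u - expR ((u - y) / alpha - 1) * alpha / c) =
      c * phi u - alpha * expR ((u - y) / alpha - 1) by field; rewrite gt_eqF.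
  rewrite /d; lra.
exists (A2 * c), (A2 * D + B2); split; first exact: mulr_gt0.
  by rewrite addr_ge0// mulr_ge0// ltW.
move=> y Q hQ; pose d := alpha * (ln c + ln alpha).
have := h2 (y - d); rewrite -/d subrK => hy.
suff : g (y - d) <= c * Q + D by move=> /(ler_wpM2l (ltW A20)); lra.
apply: root_conj_le => u.
have := ler_wpM2l (ltW c0) (hQ u); have := phih u.
have := ler_wpM2l (ltW c0) (Tle (u - y)).
have -> : (u - (y - d)) / alpha = (u - y) / alpha + (ln c + ln alpha).
  by rewrite /d; field; rewrite gt_eqF.
rewrite !expRD !lnK//; lra.
Qed.

(** The error must be linear in [x], while [phi] at a near-maximiser need not be [O(x)]. So
    increments are measured by the slope, through [growth_of_slope], and not by [growth]. *)
Lemma root_conj_lower : exists2 C : R, 0 <= C & forall x, 0 <= x ->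
  exists y, psi x - alpha * (x * ln (1 + x)) - C * (1 + x) <= x * y - g y.
Proof.
have [A A0 hA] := growth_of_slope.
have A20 : 0 <= 2 * A by lra.
have [H H0 hH] := mul_expR_bounded alpha_gt0 alpha_lt_b A20.
exists (1 + H) => [|x x0]; first lra.
(* z need not be a maximiser, but the slope at z - 1 is at most x + 1. *)
have [z z0 hz] := phi_star_approx x0.
have [x1 x10 x1z] := logweight_subgradient (z - 1).
have zz : phi (z - 1) <= phi z by apply: logweight_nd; lra.
have x1x : x1 <= x + 1.
  by have := x1z z; have := phi_star_ge (z - 1) x0; lra.
(* This shift multiplies the exponential by [1 + x], the factor that also bounds the slope, so that
   [exp (s / alpha)] can be set against [s exp (s / b)]. *)
exists (z - 1 - alpha * ln (1 + x)).
suff : g (z - 1 - alpha * ln (1 + x)) <= phi z + (1 + x) * H by lra.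
apply: root_conj_le => u.
have xH : 0 <= (1 + x) * H by rewrite mulr_ge0//; lra.
have [zu|uz] := leP (z - 1) u; last first.
  have : phi u <= phi z by apply: logweight_nd; lra.
  have := expR_ge0 ((u - (z - 1 - alpha * ln (1 + x))) / alpha); lra.
pose s := u - (z - 1).
have s0 : 0 <= s by rewrite /s; lra.
have -> : (u - (z - 1 - alpha * ln (1 + x))) / alpha = s / alpha + ln (1 + x).
  by rewrite /s; field; rewrite gt_eqF.
rewrite expRD lnK ?posrE; last lra.
have := hA _ _ _ s0 x10 x1z.
rewrite (_ : z - 1 + s = u); last by rewrite /s; lra.
have : A * (x1 + 1) * s * expR (s / b) <= (1 + x) * (2 * A * s * expR (s / b)).
  have -> : (1 + x) * (2 * A * s * expR (s / b)) =
    A * (2 * (1 + x)) * s * expR (s / b) by ring.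
  by rewrite ler_wpM2r ?expR_ge0// ler_wpM2r// ler_wpM2l//; lra.
have : (1 + x) * (2 * A * s * expR (s / b)) <= (1 + x) * (expR (s / alpha) + H).
  by rewrite ler_wpM2l ?hH//; lra.
lra.
Qed.

End Thilliez.
End Growth.

(** * Weights in the logarithmic variable *)

Section Sups.
Context {R : realType}.

Lemma ereal_sup_real (I : Type) (A : set I) (F : I -> R) (B : R) :
  A !=set0 -> (forall i, A i -> F i <= B) ->
  ereal_sup [set (F i)%:E | i in A] = (sup [set F i | i in A])%:E.
Proof.
move=> [i0 Ai0] hB; rewrite -ereal_sup_EFin; last 2 first.
- by exists B => _ [i Ai <-]; apply: hB.
- by exists (F i0), i0.
by congr ereal_sup; rewrite -image_comp.
Qed.

Lemma ge0_expR_case (P : R -> Prop) :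
  P 0 -> (forall u, P (expR u)) -> forall r, 0 <= r -> P r.
Proof.
move=> P0 Pe r; rewrite le_eqVlt => /orP[/eqP <-//|r0].
by rewrite -[r]lnK ?posrE.
Qed.

Definition log_small (h : R -> R) := forall e : R, 0 < e ->
  exists2 C : R, 0 <= C & forall y, y <= e * h y + C.

(* h is s in the logarithmic variable. *)
Definition weight_equiv (g : R -> R) (s : R -> \bar R) (h : R -> R) : Prop :=
  [/\ s 0 = 0%E, forall y, s (expR y) = (h y)%:E, forall y, 0 <= h y,
      {homo h : x y / x <= y}
    & exists A B : R, [/\ 0 < A, 0 <= B, forall y, h y <= A * g y + B
        & forall y, g y <= A * h y + B]].

(** All five weight functions come through this criterion. The member [i0] makes the supremum
    nonnegative; the lower estimate is stated for arbitrary upper bounds [Q], so that it can be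
    proved before the supremum is known to be finite. *)
Lemma weight_equiv_sup (g : R -> R) (s : R -> \bar R) (I : Type) (D : set I)
    (F : I -> R -> R) (i0 : I) (A B A' B' : R) :
  (forall y, 0 <= g y) -> s 0 = 0%E ->
  (forall y, s (expR y) = ereal_sup [set (F i y)%:E | i in D]) ->
  D i0 -> (forall y, 0 <= F i0 y) ->
  (forall i, D i -> {homo F i : x y / x <= y}) ->
  0 < A -> 0 <= B -> (forall i y, D i -> F i y <= A * g y + B) ->
  0 < A' -> 0 <= B' ->
  (forall y Q, (forall i, D i -> F i y <= Q) -> g y <= A' * Q + B') ->
  exists h, weight_equiv g s h.
Proof.
move=> g0 s0 sE Di0 F0 Fnd A0 B0 hU A'0 B'0 hL.
pose h y := sup [set F i y | i in D].
have ne y : [set F i y | i in D] !=set0 by exists (F i0 y), i0.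
have ub y : has_ubound [set F i y | i in D].
  by exists (A * g y + B) => _ [i Di <-]; apply: hU.
have hge i y : D i -> F i y <= h y.
  by move=> Di; apply: ub_le_sup => //; exists i.
have h0 y : 0 <= h y := le_trans (F0 y) (hge _ _ Di0).
have hle y : h y <= A * g y + B by apply: ge_sup => // _ [i Di <-]; apply: hU.
have gle y : g y <= A' * h y + B' by apply: hL => i Di; apply: hge.
exists h; split => //.
- move=> y; rewrite sE (@ereal_sup_real _ _ _ (A * g y + B))//.
    by exists i0.
  by move=> i; apply: hU.
- move=> x y xy; apply: ge_sup => // _ [i Di <-].
  exact: le_trans (Fnd i Di _ _ xy) (hge _ _ Di).
exists (A + A'), (B + B'); split; [exact: addr_gt0|exact: addr_ge0| |] => y.
  have := hle y; have := mulr_ge0 (ltW A'0) (g0 y); lra.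
have := gle y; have := mulr_ge0 (ltW A0) (h0 y); lra.
Qed.

Lemma weight_equiv_log (g : R -> R) s h :
  log_small g -> weight_equiv g s h -> log_small h.
Proof.
move=> glog [_ _ _ _ [A [B [A0 B0 _ gh]]]] e e0.
have [C C0 hC] := glog (e / A) (divr_gt0 e0 A0).
exists (e / A * B + C) => [|y].
  by rewrite addr_ge0// mulr_ge0// divr_ge0// ltW.
apply: (le_trans (hC y)).
have := ler_wpM2l (ltW (divr_gt0 e0 A0)) (gh y).
have -> : e / A * (A * h y + B) = e * h y + e / A * B by field; rewrite gt_eqF.
lra.
Qed.

Lemma weight_equiv_admissible (g : R -> R) s h :
  log_small g -> weight_equiv g s h -> admissible s.
Proof.
move=> glog gsh; have hlog := weight_equiv_log glog gsh.
case: gsh => s0 sE h0 hnd _; split.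
- by apply: ge0_expR_case => [|u]; rewrite ?s0 ?lexx ?ltry// sE lee_fin h0 ltry.
- suff H t : 0 <= t -> forall u, t <= u -> (s t <= s u)%E.
    by move=> t u /H; apply.
  move: t; apply: ge0_expR_case => [|x u].
    by rewrite s0; apply: ge0_expR_case => [|y]; rewrite ?s0// sE lee_fin.
  move=> xu; have u0 : 0 < u := lt_le_trans (expR_gt0 x) xu.
  move: xu; rewrite -[u]lnK ?posrE// ler_expR !sE lee_fin; exact: hnd.
move=> e e0; have e20 : 0 < e / 2 by lra.
have [C C0 hC] := hlog _ e20.
exists (expR (2 * C)); split; first exact: num_real.
move=> t ht /=; have t0 : 0 < t := lt_trans (expR_gt0 _) ht.
move: ht; rewrite -[t]lnK ?posrE// ltr_expR expRK sE/= => Ct.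
rewrite !ger0_norm ?h0//; last lra.
by have := hC (ln t); lra.
Qed.

Lemma assoc_weight0 (M : nat -> R) :
  M 0%N = 1 -> assoc_weight M 0 = 0%E.
Proof.
move=> M0; apply/eqP; rewrite eq_le; apply/andP; split.
  apply: ge_ereal_sup => _ [[|p] _ <-].
    by rewrite expr0 M0 divr1 lne1.
  by rewrite exprS !mul0r le0_lneNy// leNye.
by apply: ereal_sup_ubound; exists 0%N => //; rewrite expr0 M0 divr1 lne1.
Qed.

Lemma assoc_weight_expR (M : nat -> R) y : (forall p, 0 < M p) ->
  assoc_weight M (expR y) =
  ereal_sup [set (p%:R * y - ln (M p))%:E | p in [set: nat]].
Proof.
move=> M0; congr ereal_sup; apply: eq_imagel => p _.
rewrite lne_EFin ?divr_gt0 ?exprn_gt0 ?expR_gt0//.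
by rewrite ln_div ?posrE ?exprn_gt0 ?expR_gt0// -expRM_natl expRK.
Qed.

Lemma assoc_weight_real (M : nat -> R) (b : R -> R) : (forall p, 0 < M p) ->
  (forall p y, p%:R * y - ln (M p) <= b y) ->
  exists h : R -> R, [/\ forall y, assoc_weight M (expR y) = (h y)%:E,
    {homo h : x y / x <= y}, forall y, h y <= b y
    & forall p y, p%:R * y - ln (M p) <= h y].
Proof.
move=> M0 hb; exists (fun y => sup [set p%:R * y - ln (M p) | p in [set: nat]]).
have ne y : [set p%:R * y - ln (M p) | p in [set: nat]] !=set0.
  by exists (0%:R * y - ln (M 0%N)), 0%N.
have ge p y : p%:R * y - ln (M p) <=
    sup [set p%:R * y - ln (M p) | p in [set: nat]].
  by apply: ub_le_sup; [exists (b y) => _ [q _ <-]|exists p].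
split => //.
- move=> y; rewrite assoc_weight_expR// (@ereal_sup_real _ _ _ (b y))//.
- move=> x y xy; apply: ge_sup => // _ [p _ <-].
  by apply: le_trans (ge p y); rewrite lerD2r ler_wpM2l.
by move=> y; apply: ge_sup => // _ [p _ <-].
Qed.

Lemma gevrey_gt0 (a : R) p : 0 < gevrey a p.
Proof. by rewrite /gevrey powR_gt0// ltr0n fact_gt0. Qed.

Lemma ln_gevrey (a : R) p : ln (gevrey a p) = a * ln p`!%:R.
Proof. by rewrite /gevrey ln_powR. Qed.

Lemma gevrey0 (a : R) : gevrey a 0 = 1.
Proof. by rewrite /gevrey fact0 powR1. Qed.

Lemma assoc_gevrey (a : R) : 0 < a ->
  exists T : R -> R, [/\ forall v, assoc_weight (gevrey a) (expR v) = (T v)%:E,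
    {homo T : x y / x <= y}, forall v, T v <= a * expR (v / a)
    & forall v, a * (expR (v / a - 1) - 1) <= T v].
Proof.
move=> a0.
have hb p y : p%:R * y - ln (gevrey a p) <= a * expR (y / a).
  rewrite ln_gevrey; have := ler_wpM2l (ltW a0) (ln_fact_ge p (y / a)).
  have -> : a * (p%:R * (y / a) - expR (y / a)) =
    p%:R * y - a * expR (y / a) by field; rewrite gt_eqF.
  lra.
have [T [TE Tnd Tle Tge]] := assoc_weight_real (gevrey_gt0 a) hb.
exists T; split => // v.
(* For this [p], [p ln p <= p (v / a - 1)], so the term of index [p] is at least [a p]. *)
have := truncn_itv (expR_ge0 (v / a - 1)); set p := Num.trunc _ => /andP[pv vp].
apply: le_trans (Tge p v); rewrite ln_gevrey.
have : p%:R * ln p%:R <= p%:R * (v / a - 1) :> R.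
  have [->|p0] := posnP p; first by rewrite !mul0r.
  by rewrite ler_wpM2l// -ler_expR lnK// posrE ltr0n.
move=> /(le_trans (ln_fact_le p)) /(ler_wpM2l (ltW a0)).
have -> : a * (p%:R * (v / a - 1)) = p%:R * v - a * p%:R.
  by field; rewrite gt_eqF.
rewrite -natr1 in vp; have := ltW vp => /(ler_wpM2l (ltW a0)); lra.
Qed.

Lemma hat_star_equiv (g : R -> R) (s t : R -> \bar R) (h T : R -> R)
    (A B A' B' : R) :
  (forall y, 0 <= g y) -> s 0 = 0%E -> t 0 = 0%E ->
  (forall y, s (expR y) = (h y)%:E) -> (forall y, t (expR y) = (T y)%:E) ->
  {homo T : x y / x <= y} ->
  0 < A -> 0 <= B -> (forall u y, h u - T (u - y) <= A * g y + B) ->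
  0 < A' -> 0 <= B' ->
  (forall y Q, (forall u, h u - T (u - y) <= Q) -> g y <= A' * Q + B') ->
  exists k, weight_equiv g (hat_star s t) k.
Proof.
move=> g0 s0 t0 sE tE Tnd A0 B0 hU A'0 B'0 hL.
pose F r y := fine (s r) - fine (t (r / expR y)).
have F0 y : F 0 y = 0 by rewrite /F mul0r s0 t0 subrr.
have FE u y : F (expR u) y = h u - T (u - y).
  by rewrite /F -expRB sE tE.
apply: (@weight_equiv_sup _ _ R `[0, +oo[ F 0 A B A' B') => //.
- by rewrite /hat_star eqxx s0 t0 sube0.
- move=> y; rewrite /hat_star gt_eqF ?expR_gt0//; congr ereal_sup.
  apply: eq_imagel => r; rewrite /= in_itv/= andbT; move: r.
  apply: ge0_expR_case => [|u].
    by rewrite F0 mul0r s0 t0 sube0.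
  by rewrite FE -expRB sE tE EFinB.
- by rewrite /= in_itv/= lexx.
- by move=> y; rewrite F0.
- move=> r; rewrite /= in_itv/= andbT; move: r.
  apply: ge0_expR_case => [|u] x y xy; first by rewrite !F0.
  by rewrite !FE lerD2l lerN2; apply: Tnd; rewrite lerD2l lerN2.
- move=> r y; rewrite /= in_itv/= andbT; move: r.
  apply: ge0_expR_case => [|u]; last by rewrite FE.
  by rewrite F0 addr_ge0// mulr_ge0// ltW.
- move=> y Q hQ; apply: hL => u; rewrite -FE; apply: hQ.
  by rewrite /= in_itv/= expR_ge0.
Qed.

End Sups.

(** * Step limits of seminormed spaces *)

Section Spaces.
Context {R : realType} {T : Type}.
Local Notation V := (T -> Cx R).

Definition dominated (a b : nat -> R) : Prop :=
  exists2 C : R, 0 < C & forall p, a p <= C * b p.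

(* The common shape of the seminorms of all the classes. *)
Definition weighted_sup (Ix : Type) (A : set Ix) (N : V -> Ix -> R)
    (deg : Ix -> nat) (a : nat -> R) (f : V) : \bar R :=
  ereal_sup [set (N f i / a (deg i))%:E | i in A].

Section Steps.
Context (X0 : set V) (Ix : Type) (A : set Ix) (N : V -> Ix -> R).
Context (deg : Ix -> nat).
Context (N_ge0 : forall f i, A i -> 0 <= N f i).
Context (N0 : forall i, A i -> N 0 i = 0).

Let q := weighted_sup A N deg.
Let L a := seminormed X0 (q a).

Lemma weighted_sup_le (a b : nat -> R) (C e : R) f :
  (forall p, 0 < a p) -> (forall p, 0 < b p) -> 0 < C ->
  (forall p, a p <= C * b p) -> (q a f <= e%:E -> q b f <= (C * e)%:E)%E.
Proof.
move=> a0 b0 C0 ab hq; apply: ge_ereal_sup => _ [i Ai <-]; rewrite lee_fin.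
have : ((N f i / a (deg i))%:E <= e%:E)%E.
  by apply: le_trans hq; apply: ereal_sup_ubound; exists i.
rewrite lee_fin !ler_pdivrMr// => hN; apply: (le_trans hN).
have N_e : 0 <= e.
  by have := le_trans (N_ge0 f Ai) hN; rewrite pmulr_lge0.
by rewrite (mulrC C) -mulrA ler_wpM2l.
Qed.

Lemma step_carrier (a b : nat -> R) :
  (forall p, 0 < a p) -> (forall p, 0 < b p) -> dominated a b ->
  carrier (L a) `<=` carrier (L b).
Proof.
move=> a0 b0 [C C0 ab] f [Xf qf]; split=> //.
(* If the index set is empty, [q a f] is [-oo] and any real bound serves. *)
have [e he] : exists e : R, (q a f <= e%:E)%E.
  by move: qf; case: (q a f) => [r _|//|_]; [exists r|exists 0; rewrite leNye].
apply: le_lt_trans (weighted_sup_le a0 b0 C0 ab he) _; exact: ltry.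
Qed.

Lemma step_opens (a b : nat -> R) (B : set V) :
  (forall p, 0 < a p) -> (forall p, 0 < b p) -> dominated a b ->
  opens (L b) B -> opens (L a) (B `&` carrier (L a)).
Proof.
move=> a0 b0 ab [BX hB]; split; first exact: subIsetr.
move=> f [Bf Xf]; have [e e0 he] := hB f Bf.
have sub := step_carrier a0 b0 ab.
have [C C0 hC] := ab.
(* [weighted_sup_le] yields a non-strict bound; the factor 2 restores strictness. *)
exists (e / (2 * C)); first by rewrite divr_gt0// mulr_gt0.
move=> g Xg hg; split => //; apply: he; first exact: sub.
apply: le_lt_trans (weighted_sup_le a0 b0 C0 hC (ltW hg)) _.
rewrite lte_fin; have -> : C * (e / (2 * C)) = e / 2 by field; rewrite gt_eqF.
lra.
Qed.

Lemma step_zero (a : nat -> R) : X0 0 -> carrier (L a) 0.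
Proof.
move=> X00; split=> //; apply: (@le_lt_trans _ _ 0%E); last exact: ltry.
by apply: ge_ereal_sup => _ [i Ai <-]; rewrite N0// mul0r.
Qed.

Section Families.
Context (J J' : eqType) (a : J -> nat -> R) (b : J' -> nat -> R).
Context (a_gt0 : forall j p, 0 < a j p) (b_gt0 : forall j p, 0 < b j p).

Lemma ind_lim_carrier : (forall j, exists j', dominated (a j) (b j')) ->
  carrier (ind_lim (fun j => L (a j))) `<=`
    carrier (ind_lim (fun j => L (b j))).
Proof.
move=> ab f [j _ Lf]; have [j' jj'] := ab j.
by exists j' => //; apply: step_carrier jj' _ Lf.
Qed.

(** The same absolutely convex [D] serves on both sides: a step [a j] embeds continuously into some
    step [b j'], whose neighbourhood of 0 inside [D] is pulled back. *)
Lemma ind_lim_opens : (forall j, exists j', dominated (a j) (b j')) ->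
  carrier (ind_lim (fun j => L (a j))) = carrier (ind_lim (fun j => L (b j))) ->
  opens (ind_lim (fun j => L (b j))) `<=` opens (ind_lim (fun j => L (a j))).
Proof.
move=> ab; rewrite /ind_lim /= => XE O [OX hO]; rewrite XE; split => // f Of.
have [D [Dabs DX hD Df]] := hO f Of; exists D; split => // j.
have [j' jj'] := ab j; have [B [Bop B0 BD]] := hD j'.
exists (B `&` carrier (L (a j))); split; last by move=> x [/BD].
  exact: step_opens jj' Bop.
split=> //; apply: step_zero.
by have [/(_ _ B0)[]] := Bop.
Qed.

Lemma proj_lim_carrier : (forall j', exists j, dominated (a j) (b j')) ->
  carrier (proj_lim (fun j => L (a j))) `<=`
    carrier (proj_lim (fun j => L (b j))).
Proof.
move=> ab f; rewrite /proj_lim /= => Lf j' _; have [j jj'] := ab j'.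
by apply: step_carrier jj' _ (Lf j I).
Qed.

Lemma finite_common_radius (K : eqType) (s : set K) (P : K -> R -> Prop) :
  finite_set s ->
  (forall k (e e' : R), e' <= e -> P k e -> P k e') ->
  (forall k, s k -> exists2 e : R, 0 < e & P k e) ->
  exists2 e : R, 0 < e & forall k, s k -> P k e.
Proof.
move=> /finite_seqP[l ->] Pmono; elim: l => [|k l IH] h.
  by exists 1.
have [e e0 he] : exists2 e : R, 0 < e & forall k, [set` l] k -> P k e.
  by apply: IH => k' k'l; apply: h; rewrite /= inE; apply/orP; right.
have [e' e'0 he'] : exists2 e : R, 0 < e & P k e.
  by apply: h; rewrite /= inE eqxx.
exists (Num.min e e'); first by rewrite lt_min e0.
move=> k' /=; rewrite inE => /orP[/eqP ->|k'l].
  by apply: Pmono he'; rewrite ge_min lexx orbT.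
by apply: Pmono (he _ k'l); rewrite ge_min lexx.
Qed.

Lemma proj_lim_opens : (forall j', exists j, dominated (a j) (b j')) ->
  carrier (proj_lim (fun j => L (a j))) =
    carrier (proj_lim (fun j => L (b j))) ->
  opens (proj_lim (fun j => L (b j))) `<=` opens (proj_lim (fun j => L (a j))).
Proof.
move=> /choice[h hh]; rewrite /proj_lim /= => XE O [OX hO].
rewrite XE; split => // f Of.
have [s [B [sfin sB sub]]] := hO f Of.
(* Several [j'] in [s] may be sent to the same [j], whose open set must then meet all their
   constraints; as [s] is finite they share a radius. *)
exists (h @` s), (fun j => [set f | carrier (L (a j)) f /\
  forall j', s j' -> h j' = j -> B j' f]); split.
- exact: finite_image.
- move=> j _; have fX : forall j, carrier (L (a j)) f.
    by move=> i; have := OX _ Of; rewrite -XE => /(_ i I).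
  split; last by split => // j' /sB[].
  split; first by move=> x [].
  move=> g [Xg Bg].
  have [e e0 he] : exists2 e : R, 0 < e & forall j', s j' -> h j' = j ->
      forall k, carrier (L (a j)) k -> (q (a j) (k - g)%R < e%:E)%E -> B j' k.
    apply: finite_common_radius => // [j' e e' ee' P /P{}P k /P{}P hk|j' sj'].
      by apply: P; apply: lt_le_trans hk _; rewrite lee_fin.
    have [hj'|hj'] := pselect (h j' = j); last by exists 1.
    have [_ /(_ g)] : opens (L (a j)) (B j' `&` carrier (L (a j))).
      by rewrite -hj'; apply: step_opens (hh j') (proj1 (sB _ sj')).
    case=> [|e e0 he]; first by split => //; apply: Bg.
    by exists e => // _ k Xk /(he _ Xk)[].
  by exists e => // k Xk hk; split => // j' sj' hj'; apply: he hk.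
move=> k [Xk Bk]; apply: sub; split => //.
by move=> j' sj'; have [|_] := Bk (h j'); [exists j'|apply].
Qed.

End Families.

Lemma lcs_eq (E F : lcs R T) :
  carrier E = carrier F -> opens E = opens F -> E = F.
Proof. by case: E F => [? ?] [? ?] /= -> ->. Qed.

(** The first two dominations settle the Roumieu case, where each step must lie in a step of the
    other family; the last two settle the Beurling case, where each step must contain one. *)
Lemma step_lim_eq (J J' : eqType) (a : J -> nat -> R) (b : J' -> nat -> R) k :
  (forall j p, 0 < a j p) -> (forall j p, 0 < b j p) ->
  (forall j, exists j', dominated (a j) (b j')) ->
  (forall j', exists j, dominated (b j') (a j)) ->
  (forall j', exists j, dominated (a j) (b j')) ->
  (forall j, exists j', dominated (b j') (a j)) ->
  step_lim k (fun j => L (a j)) = step_lim k (fun j => L (b j)).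
Proof.
move=> a0 b0 ab ba ab' ba'; case: k => /=.
  have XE : carrier (ind_lim (fun j => L (a j))) =
      carrier (ind_lim (fun j => L (b j))).
    by apply/seteqP; split; apply: ind_lim_carrier.
  by apply: lcs_eq => //; apply/seteqP; split; apply: ind_lim_opens.
have XE : carrier (proj_lim (fun j => L (a j))) =
    carrier (proj_lim (fun j => L (b j))).
  by apply/seteqP; split; apply: proj_lim_carrier.
by apply: lcs_eq => //; apply/seteqP; split; apply: proj_lim_opens.
Qed.

End Steps.
End Spaces.

(** * The standard classes have seminorms of the common shape *)

Section StandardClasses.
Context {R : realType}.

Lemma cabs_ge0 (z : Cx R) : 0 <= cabs z.
Proof. by rewrite /cabs; have := normr_ge0 z; rewrite lecE => /andP[]. Qed.

Lemma cabs0 : cabs (0 : Cx R) = 0.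
Proof. by rewrite /cabs normr0. Qed.

Lemma partials0 d (s : seq 'I_d) : partials s (0 : 'rV[R]_d -> Cx R) = 0.
Proof.
elim: s => //= i s ->; apply/funext => x; rewrite /partial.
by rewrite !(derive_cst (0 : R)).
Qed.

Lemma iter_deriv10 j : iter j deriv1 (0 : R -> Cx R) = 0.
Proof.
elim: j => //= j ->; apply/funext => x; rewrite /deriv1.
by rewrite !(derive1_cst (0 : R)).
Qed.

(** [surf_deriv] is a limit along this filter, and its value at the zero function is determined only
    if the filter is proper. Points other than [z] are found by varying the modulus alone. *)
Lemma dnbhs_pair_proper (z : R * R) : ProperFilter z^'.
Proof.
split; last exact: within_filter.
move=> [[A1 A2] /= [A1z A2z] sub].
have /filter_ex[x [xz A1x]] : \forall x \near z.1^', x != z.1 /\ A1 x.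
  by near=> x; split; near: x; [exact: nbhs_dnbhs_neq|exact: nbhs_dnbhs].
apply: (sub (x, z.2)); first by split => //=; exact: nbhs_singleton.
by apply: contra xz => /eqP <-.
Unshelve. all: by end_near. Qed.

Lemma iter_surf_deriv0 j : iter j surf_deriv (0 : R * R -> Cx R) = 0.
Proof.
elim: j => //= j ->; apply/funext => z; rewrite /surf_deriv.
have zP := dnbhs_pair_proper z.
apply: (@norm_lim_near_cst (Cx R) (Cx R)).
by near=> w; rewrite /surf_quot subrr mul0r.
Unshelve. all: by end_near. Qed.

Lemma std_class_norm (F : wclass R) (j : wc_idx F) : std_class F ->
  exists (I : Type) (A : set I) (N : (wc_dom F -> Cx R) -> I -> R)
      (deg : I -> nat),
    [/\ forall f i, A i -> 0 <= N f i, forall i, A i -> N 0 i = 0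
      & forall a, wc_norm j a = weighted_sup A N deg a].
Proof.
move=> FS; case: FS j => [d U _ _ _|d U _ _ _|x y _| | |] j.
- exists ('rV[R]_d * ('I_d -> nat))%type, [set xb | sval j xb.1],
    (fun f xb => cabs (mpartial xb.2 f xb.1)), (fun xb => mdeg xb.2).
  split => // [f i _|i _]; first exact: cabs_ge0.
  by rewrite /mpartial partials0 cabs0.
- exists ('rV[R]_d * ('I_d -> nat))%type, [set xb | U xb.1],
    (fun f xb => cabs (mpartial xb.2 f xb.1)), (fun xb => mdeg xb.2).
  split => // [f i _|i _]; first exact: cabs_ge0.
  by rewrite /mpartial partials0 cabs0.
- exists ((R * R) * nat)%type, [set zp | sector x y zp.1],
    (fun f zp => cabs (iter zp.2 surf_deriv f zp.1)), (fun zp => zp.2).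
  split => // [f i _|i _]; first exact: cabs_ge0.
  by rewrite iter_surf_deriv0 cabs0.
- exists (R * (nat * nat))%type, setT,
    (fun f xjk =>
       (1 + `|xjk.1|) ^+ xjk.2.2 * cabs (iter xjk.2.1 deriv1 f xjk.1)),
    (fun xjk => (xjk.2.1 + xjk.2.2)%N).
  split => // [f i _|i _]; last by rewrite iter_deriv10 cabs0 mulr0.
  by rewrite mulr_ge0 ?cabs_ge0// exprn_ge0// addr_ge0.
- exists nat, setT, (fun c p => cabs (c p)), id.
  by split => // [f i _|i _]; [exact: cabs_ge0|exact: cabs0].
- exists nat, setT, (fun c p => cabs (c p)), id.
  by split => // [f i _|i _]; [exact: cabs_ge0|exact: cabs0].
Qed.

End StandardClasses.

(** * Weight matrices *)

Section Matrices.
Context {R : realType}.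
Implicit Types (g h sigma tau : R -> R).

Definition conjR h (x : R) : R := sup [set x * y - h y | y in [set: R]].

Lemma conjR_ge h (x y : R) : (forall y, 0 <= h y) -> log_small h -> 0 <= x ->
  x * y - h y <= conjR h x.
Proof.
move=> h0 hlog x0; apply: ub_le_sup; last by exists y.
have e0 : 0 < (x + 1)^-1 by rewrite invr_gt0; lra.
have [C C0 hC] := hlog _ e0.
exists (x * C) => _ [z _ <-].
have := ler_wpM2l x0 (hC z); rewrite mulrDr mulrA.
have : x / (x + 1) * h z <= h z.
  by rewrite -[leRHS]mul1r ler_wpM2r// ler_pdivrMr; lra.
lra.
Qed.

Lemma conjR_le h (x Q : R) :
  (forall y, x * y - h y <= Q) -> conjR h x <= Q.
Proof.
move=> hQ; apply: ge_sup; first by exists (x * 0 - h 0), 0.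
by move=> _ [y _ <-].
Qed.

(** A translation of the weight by [d] becomes the geometric factor [exp (d p)] in its matrix; this
    is how the factors [h^p] are traded for a change of index. *)
Lemma conjR_shift sigma tau (l l' d B : R) p :
  (forall y, 0 <= sigma y) -> log_small sigma -> 0 < l -> 0 < l' ->
  (forall y, sigma (y + d) / l' <= tau y / l + B) ->
  l^-1 * conjR tau (l * p%:R) + p%:R * d <=
    l'^-1 * conjR sigma (l' * p%:R) + B.
Proof.
move=> s0 slog l0 l'0 st; rewrite -lerBrDr ler_pdivrMl//.
apply: conjR_le => y; rewrite -ler_pdivrMl//.
have := conjR_ge (y + d) s0 slog (mulr_ge0 (ltW l'0) (ler0n R p)).
have il' : 0 <= l'^-1 by rewrite invr_ge0 ltW.
move=> /(ler_wpM2l il'); have := st y.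
have -> : l'^-1 * (l' * p%:R * (y + d) - sigma (y + d)) =
  p%:R * (y + d) - sigma (y + d) / l' by field; lra.
have -> : l^-1 * (l * p%:R * y - tau y) = p%:R * y - tau y / l by field; lra.
lra.
Qed.

Lemma dominated_expR (m n : nat -> R) (C : R) :
  (forall p, m p <= n p + C) ->
  dominated (fun p => expR (m p)) (fun p => expR (n p)).
Proof.
move=> mn; exists (expR C) => [|p]; first exact: expR_gt0.
by rewrite -expRD ler_expR addrC.
Qed.

Lemma conj_matrix_dominated h h' (A B : R) (l : R) :
  (forall y, 0 <= h y) -> log_small h -> 0 < A -> 0 < l ->
  (forall y, h y <= A * h' y + B) ->
  dominated (weight_seq (conjR h') l) (weight_seq (conjR h) (A * l)).
Proof.
move=> h0 hlog A0 l0 hh'; apply: (@dominated_expR _ _ (B / (A * l))) => p.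
have Al0 : 0 < A * l by rewrite mulr_gt0.
have := @conjR_shift h h' l (A * l) 0 (B / (A * l)) p h0 hlog l0 Al0.
rewrite mulr0 addr0; apply => y; rewrite addr0.
have -> : h' y / l + B / (A * l) = (A * h' y + B) / (A * l).
  by field; rewrite !gt_eqF.
by rewrite ler_pM2r ?invr_gt0.
Qed.

Definition conj_space (F : wclass R) (k : kind) h : lcs R (wc_dom F) :=
  proj_lim (fun j : wc_idx F => step_lim k (fun l : {posnum R} =>
    seminormed (@wc_base _ F) (wc_norm j (weight_seq (conjR h) l%:num)))).

Lemma proj_step_lim_eq (F : wclass R) k (J J' : eqType)
    (a : J -> nat -> R) (b : J' -> nat -> R) : std_class F ->
  (forall j p, 0 < a j p) -> (forall j p, 0 < b j p) ->
  (forall j, exists j', dominated (a j) (b j')) ->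
  (forall j', exists j, dominated (b j') (a j)) ->
  (forall j', exists j, dominated (a j) (b j')) ->
  (forall j, exists j', dominated (b j') (a j)) ->
  proj_lim (fun i : wc_idx F => step_lim k (fun j =>
    seminormed (@wc_base _ F) (wc_norm i (a j)))) =
  proj_lim (fun i : wc_idx F => step_lim k (fun j =>
    seminormed (@wc_base _ F) (wc_norm i (b j)))).
Proof.
move=> FS a0 b0 ab ba ab' ba'; congr proj_lim; apply/funext => i.
have [Ix [S [N [deg [N0 N00 NE]]]]] := std_class_norm i FS.
have -> : wc_norm i = weighted_sup S N deg by apply/funext.
exact: step_lim_eq.
Qed.

Lemma conj_space_eq (F : wclass R) k g h (A B A' B' : R) : std_class F ->
  (forall y, 0 <= g y) -> log_small g -> (forall y, 0 <= h y) -> log_small h ->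
  0 < A -> (forall y, h y <= A * g y + B) ->
  0 < A' -> (forall y, g y <= A' * h y + B') ->
  conj_space F k g = conj_space F k h.
Proof.
move=> FS g0 glog h0 hlog A0 hg A'0 gh.
have gt0 f (l : {posnum R}) p : 0 < weight_seq (conjR f) l%:num p.
  exact: expR_gt0.
have up (l : {posnum R}) : dominated (weight_seq (conjR g) l%:num)
    (weight_seq (conjR h) (A * l%:num)) by apply: conj_matrix_dominated hg.
have up' (l : {posnum R}) : dominated (weight_seq (conjR h) l%:num)
    (weight_seq (conjR g) (A' * l%:num)) by apply: conj_matrix_dominated gh.
apply: proj_step_lim_eq => // l.
- by exists (PosNum (mulr_gt0 A0 [gt0 of l%:num])).
- by exists (PosNum (mulr_gt0 A'0 [gt0 of l%:num])).
- exists (PosNum (divr_gt0 [gt0 of l%:num] A0)).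
  have := up (PosNum (divr_gt0 [gt0 of l%:num] A0)).
  by rewrite /= mulrCA mulfV ?gt_eqF// mulr1.
- exists (PosNum (divr_gt0 [gt0 of l%:num] A'0)).
  have := up' (PosNum (divr_gt0 [gt0 of l%:num] A'0)).
  by rewrite /= mulrCA mulfV ?gt_eqF// mulr1.
Qed.

Lemma space_weight_conj (F : wclass R) k g s h : std_class F ->
  (forall y, 0 <= g y) -> log_small g -> weight_equiv g s h ->
  space_weight F k s = conj_space F k g.
Proof.
move=> FS g0 glog gsh; have hlog := weight_equiv_log glog gsh.
have [_ sE h0 _ [A [B [A0 B0 hg gh]]]] := gsh.
rewrite (conj_space_eq k FS g0 glog h0 hlog A0 hg A0 gh).
suff E : phi_starR (fine \o s) = conjR h.
  by rewrite /space_weight /conj_space /wmatrixR E.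
apply/funext => x; congr sup; apply: eq_imagel => y _.
by rewrite /= sE.
Qed.

End Matrices.

(** * Comparison of the quotient matrix and the five weights with [g] *)

Section Main.
Context {R : realType} (w : R -> R) (alpha b l0 : R).
Context (w_weight : weight0 w) (alpha_gt0 : 0 < alpha).
Context (w_small : littleo_pinfty w (fun t : R => t `^ alpha^-1)).
Context (l0_gt0 : 0 < l0) (wb : thilliez_exponent (wmatrix w l0) b).
Context (alpha_lt_b : alpha < b).

Let phi y := w (expR y).
Let psi := phi_star w.
Let g := root_conj alpha phi.

Let b_gt0 : 0 < b := lt_trans alpha_gt0 alpha_lt_b.
Let g0 : forall y, 0 <= g y := root_conj_ge0 w_weight alpha_gt0 w_small.
Let glog : log_small g := root_conj_log w_weight w_small.
Let gshift :=
  root_conj_shift w_weight alpha_gt0 w_small b_gt0 l0_gt0 wb alpha_lt_b.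

(* C does not depend on l: in the Beurling case l is chosen after C. *)
Lemma conj_root_conj_lower : exists2 C : R, 0 <= C & forall (l : R) p, 0 < l ->
  l^-1 * psi (l * p%:R) - alpha * ln p`!%:R <=
    l^-1 * conjR g (l * p%:R) + p%:R * (C + alpha * ln (1 + l)) + (C / l + C).
Proof.
have [C C0 hC] :=
  root_conj_lower w_weight alpha_gt0 b_gt0 l0_gt0 wb alpha_lt_b.
have a0 := alpha_gt0.
exists (C + alpha) => [|l p l_gt0]; first lra.
have lp0 : 0 <= l * p%:R := mulr_ge0 (ltW l_gt0) (ler0n R p).
have [y hy] := hC _ lp0.
have {hy} := le_trans hy (conjR_ge y g0 glog lp0).
have il : 0 <= l^-1 by rewrite invr_ge0 ltW.
move=> /(ler_wpM2l il).
rewrite -/psi.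
have -> : l^-1 * (psi (l * p%:R) - alpha * (l * p%:R * ln (1 + l * p%:R)) -
    C * (1 + l * p%:R)) = l^-1 * psi (l * p%:R) -
    alpha * (p%:R * ln (1 + l * p%:R)) - C / l - C * p%:R by field; lra.
have p0 := ler0n R p.
(* This separates [l] from [p]; then [ln_fact_ge] at [t = ln (1 + p)] trades [p ln (1 + p)] for
   [ln p!] at the cost of [1 + p]. *)
have : ln (1 + l * p%:R) <= ln (1 + l) + ln (1 + p%:R).
  rewrite -lnM ?posrE; [|lra|lra].
  rewrite ler_ln ?posrE; [lra|lra|].
  by rewrite mulr_gt0//; lra.
move=> /(ler_wpM2l p0) /(ler_wpM2l (ltW a0)).
have := ln_fact_ge p (ln (1 + p%:R) : R); rewrite lnK ?posrE; last lra.
move=> /(ler_wpM2l (ltW a0)).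
have : 0 <= alpha / l by rewrite divr_ge0// ltW.
by rewrite mulrDl; lra.
Qed.

Lemma conj_root_conj_upper (l : R) p : 0 < l ->
  l^-1 * conjR g (l * p%:R) <=
    l^-1 * psi (l * p%:R) - alpha * ln p`!%:R + p%:R * (1 - alpha * ln l).
Proof.
move=> l_gt0; rewrite ler_pdivrMl//; apply: conjR_le => y.
rewrite -ler_pdivrMl//.
have := root_conj_upper w_weight alpha_gt0 w_small p
  (y - (1 - alpha * ln l)) l_gt0.
rewrite subrK -/phi -/psi -/g.
have -> : l^-1 * (l * p%:R * y - g y) = p%:R * y - g y / l by field; lra.
lra.
Qed.

Let W (l : R) := weight_seq (conjR g) l.
Let M (l h : R) p := h ^+ p * seq_div (wmatrix w l) (gevrey alpha) p.

Lemma matrix_expR (l h : R) : 0 < h -> M l h = fun p =>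
  expR (p%:R * ln h + (l^-1 * psi (l * p%:R) - alpha * ln p`!%:R)).
Proof.
move=> h0; apply/funext => p; rewrite /M /seq_div.
rewrite expRD expRB expRM_natl lnK ?posrE//; congr (_ * (_ / _)).
by rewrite -ln_gevrey lnK// posrE gevrey_gt0.
Qed.

Lemma conj_shift_scaled (A B l d : R) p : 0 < A -> 0 < l ->
  (forall y, g (y + d) <= A * g y + B) ->
  l^-1 * conjR g (l * p%:R) + p%:R * d <=
    (A * l)^-1 * conjR g (A * l * p%:R) + B / (A * l).
Proof.
move=> A0 l_gt0 hA; have Al0 : 0 < A * l by rewrite mulr_gt0.
apply: conjR_shift => // y.
have -> : g y / l + B / (A * l) = (A * g y + B) / (A * l).
  by field; rewrite !gt_eqF.
by rewrite ler_pM2r ?invr_gt0.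
Qed.

Lemma matrix_dominated_by_conj (l h : R) : 0 < l -> 0 < h ->
  exists2 l', 0 < l' & dominated (M l h) (W l').
Proof.
move=> l_gt0 h0; have [C C0 hC] := conj_root_conj_lower.
have [A [B [A0 B0 hA]]] := gshift (C + alpha * ln (1 + l) + ln h).
exists (A * l); first exact: mulr_gt0.
rewrite matrix_expR//; apply: (@dominated_expR _ _ _ (B / (A * l) + (C / l + C))).
by move=> p; have := conj_shift_scaled p A0 l_gt0 hA; have := hC _ p l_gt0; lra.
Qed.

Lemma conj_dominates_matrix (l' : R) : 0 < l' ->
  exists l h : R, [/\ 0 < l, 0 < h & dominated (M l h) (W l')].
Proof.
move=> l'0; have [C C0 hC] := conj_root_conj_lower.
(* Capping [l] at 1 bounds [ln (1 + l)] by [ln 2], so the shift, and with it [A], is fixed before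
   [l] is chosen with [A l <= l']. *)
have [A [B [A0 B0 hA]]] := gshift (C + alpha * ln 2).
have a0 := alpha_gt0.
pose l := Num.min 1 (l' / A).
have l_gt0 : 0 < l by rewrite lt_min ltr01 divr_gt0.
have l1 : l <= 1 by rewrite ge_min lexx.
have Al : A * l <= l'.
  by rewrite mulrC -ler_pdivlMr// ge_min lexx orbT.
exists l, 1; split => //.
rewrite matrix_expR// ln1; apply: (@dominated_expR _ _ _ (B / l' + (C / l + C))).
move=> p; have := hC _ p l_gt0.
have := @conjR_shift _ g g l l' (C + alpha * ln 2) (B / l') p g0 glog l_gt0 l'0.
have H y : g (y + (C + alpha * ln 2)) / l' <= g y / l + B / l'.
  have := hA y; rewrite -(ler_pM2r (x := l'^-1)) ?invr_gt0// => hy.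
  apply: (le_trans hy); rewrite mulrDl lerD2r ler_pdivrMr// mulrAC.
  rewrite ler_pdivlMr// mulrAC -mulrA [leRHS]mulrC mulrA -/g.
  have := ler_wpM2l (g0 y) Al; rewrite -/g; lra.
move=> /(_ H).
have : ln (1 + l) <= ln 2 by rewrite ler_ln ?posrE; lra.
move=> /(ler_wpM2l (ltW a0)) /(ler_wpM2l (ler0n R p)).
rewrite /W /weight_seq; lra.
Qed.

Lemma conj_dominated_by_matrix (l' : R) : 0 < l' ->
  exists l h : R, [/\ 0 < l, 0 < h & dominated (W l') (M l h)].
Proof.
move=> l'0; exists l', (expR (1 - alpha * ln l')); split => //.
  exact: expR_gt0.
rewrite matrix_expR ?expR_gt0// expRK.
apply: (@dominated_expR _ _ _ 0) => p.
by have := conj_root_conj_upper p l'0; lra.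
Qed.

Lemma matrix_dominates_conj (l h : R) : 0 < l -> 0 < h ->
  exists2 l', 0 < l' & dominated (W l') (M l h).
Proof.
move=> l_gt0 h0.
have [A [B [A0 B0 hA]]] := gshift (1 - alpha * ln l - ln h).
have lA0 : 0 < l / A by rewrite divr_gt0.
have lA : A * (l / A) = l by field; rewrite gt_eqF.
exists (l / A) => //; rewrite matrix_expR//.
apply: (@dominated_expR _ _ _ (B / l)) => p.
have := conj_shift_scaled p A0 lA0 hA; rewrite lA.
have := conj_root_conj_upper p l_gt0; lra.
Qed.

Lemma space_matrix_conj (F : wclass R) k : std_class F ->
  space_matrix F k (fun m => seq_div (wmatrix w m) (gevrey alpha)) =
  conj_space F k g.
Proof.
move=> FS.
apply: (@proj_step_lim_eq _ _ _ _ _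
  (fun lh : {posnum R} * {posnum R} => M lh.1%:num lh.2%:num)) => //.
- by move=> lh p; rewrite matrix_expR ?expR_gt0.
- by move=> l p; apply: expR_gt0.
- move=> [l h] /=.
  have [l' l'0 ?] := matrix_dominated_by_conj [gt0 of l%:num] [gt0 of h%:num].
  by exists (PosNum l'0).
- move=> l'.
  have [l [h [l_gt0 h_gt0 ?]]] := conj_dominated_by_matrix [gt0 of l'%:num].
  by exists (PosNum l_gt0, PosNum h_gt0).
- move=> l'.
  have [l [h [l_gt0 h_gt0 ?]]] := conj_dominates_matrix [gt0 of l'%:num].
  by exists (PosNum l_gt0, PosNum h_gt0).
- move=> [l h] /=.
  have [l' l'0 ?] := matrix_dominates_conj [gt0 of l%:num] [gt0 of h%:num].
  by exists (PosNum l'0).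
Qed.

(** [root_conj_upper] and [root_conj_le_assoc] give the two estimates up to translations of the
    argument, which [gshift] removes. *)
Lemma assoc_quotient_equiv (l : R) : 0 < l -> exists h,
  weight_equiv g (assoc_weight (seq_div (wmatrix w l) (gevrey alpha))) h.
Proof.
move=> l_gt0; have a0 := alpha_gt0.
pose s p : R := seq_div (wmatrix w l) (gevrey alpha) p.
have s0 p : 0 < s p by rewrite divr_gt0 ?gevrey_gt0 ?expR_gt0.
have lns p : ln (s p) = psi (l * p%:R) / l - alpha * ln p`!%:R.
  by rewrite ln_div ?posrE ?gevrey_gt0 ?expR_gt0// ln_gevrey expRK mulrC.
have [A1 [B1 [A10 B10 h1]]] := gshift (1 - alpha * ln l).
have [c [A2 [C [A20 C0 h2]]]] :=
  root_conj_le_assoc w_weight alpha_gt0 w_small l_gt0.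
have [A3 [B3 [A30 B30 h3]]] := gshift c.
have il : 0 < l^-1 by rewrite invr_gt0.
have M00 : s 0%N = 1.
  rewrite /s /seq_div gevrey0 divr1 /wmatrix /weight_seq mulr0 phi_star0//.
  by rewrite mulr0 expR0.
apply: (@weight_equiv_sup _ _ _ nat setT (fun p y => p%:R * y - ln (s p)) 0%N
   (A1 / l) (B1 / l) (A3 * A2) (A3 * C + B3)) => //.
- exact: assoc_weight0.
- by move=> y; rewrite assoc_weight_expR.
- by move=> y; rewrite mul0r M00 ln1 subr0.
- by move=> p _ x y xy; rewrite lerD2r ler_wpM2l.
- exact: mulr_gt0.
- by rewrite mulr_ge0// ltW.
- move=> p y _; rewrite lns.
  have := root_conj_upper w_weight alpha_gt0 w_small p y l_gt0.
  have := ler_wpM2r (ltW il) (h1 y); rewrite -/phi -/psi -/g; lra.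
- exact: mulr_gt0.
- by rewrite addr_ge0// mulr_ge0// ltW.
move=> y Q hQ; have := h3 (y - c); rewrite subrK => hy.
have : g (y - c) <= A2 * Q + C.
  apply: h2 => p; rewrite subrK; have := hQ p I; rewrite lns -/psi; lra.
move=> /(ler_wpM2l (ltW A30)); move: hy; rewrite -/phi -/g; lra.
Qed.

Lemma hat_star_gevrey_equiv (s : R -> \bar R) (h : R -> R) (c D : R) :
  s 0 = 0%E -> (forall y, s (expR y) = (h y)%:E) -> 0 < c -> 0 <= D ->
  (forall u, h u <= c * phi u + D) -> (forall u, phi u <= c * h u + D) ->
  exists k, weight_equiv g (hat_star s (assoc_weight (gevrey alpha))) k.
Proof.
move=> s0 sE c0 D0 hphi phih.
have [T [TE Tnd Tle Tge]] := assoc_gevrey alpha_gt0.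
have [A [B [A0 B0 hU [A' [B' [A'0 B'0 hL]]]]]] :=
  root_conj_equiv w_weight alpha_gt0 w_small b_gt0 l0_gt0 wb alpha_lt_b
    c0 D0 hphi phih Tle Tge.
apply: hat_star_equiv Tnd A0 B0 hU A'0 B'0 hL => //.
by rewrite assoc_weight0// gevrey0.
Qed.

Lemma hat_star_assoc_equiv (l : R) : 0 < l -> exists h, weight_equiv g
  (hat_star (assoc_weight (wmatrix w l)) (assoc_weight (gevrey alpha))) h.
Proof.
move=> l_gt0.
have W0 p : 0 < wmatrix w l p by apply: expR_gt0.
have lnW p : ln (wmatrix w l p) = psi (l * p%:R) / l by rewrite expRK mulrC.
have hb p u : p%:R * u - ln (wmatrix w l p) <= phi u / l.
  by rewrite lnW; apply: assoc_le_logweight.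
have [h [hE _ hle hge]] := assoc_weight_real W0 hb.
have [C C0 hC] := logweight_le_assoc w_weight l_gt0.
have phih u : phi u <= 2 * l * h u + C.
  by apply: hC => p; rewrite -lnW.
have h0 u : 0 <= h u.
  apply: le_trans (hge 0%N u).
  by rewrite lnW mul0r mulr0 /psi phi_star0// mul0r subr0.
have phi0 u : 0 <= phi u := logweight_ge0 w_weight u.
have il : 0 < l^-1 by rewrite invr_gt0.
(* The sum is one constant for both comparisons, [h <= phi / l] and [phi <= 2 l h + C]. *)
apply: (@hat_star_gevrey_equiv _ h (l^-1 + 2 * l) C) => //.
- by rewrite assoc_weight0// /wmatrix /weight_seq mulr0 phi_star0// mulr0 expR0.
- lra.
- move=> u; have := hle u; have := mulr_ge0 (ltW l_gt0) (phi0 u); lra.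
- move=> u; have := phih u; have := mulr_ge0 (ltW il) (h0 u); lra.
Qed.

Lemma hat_star_weight_equiv : exists h, weight_equiv g
  (hat_star (EFin \o w) (assoc_weight (gevrey alpha))) h.
Proof.
apply: (@hat_star_gevrey_equiv _ phi 1 0) => //.
- by rewrite /= (weight0_eq0 w_weight)// lexx ler01.
- by move=> u; rewrite mul1r addr0.
- by move=> u; rewrite mul1r addr0.
Qed.

Lemma hat_star_root_equiv : exists h, weight_equiv g
  (hat_star (EFin \o w) (id_root alpha)) h.
Proof.
have av : 0 < alpha^-1 by rewrite invr_gt0.
apply: (@hat_star_equiv _ g _ _ phi (fun v => expR (v / alpha)) 1 0 1 0) => //.
- by rewrite /= (weight0_eq0 w_weight)// lexx ler01.
- by rewrite /id_root powR0 ?gt_eqF.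
- by move=> v; rewrite /id_root /powR gt_eqF ?expR_gt0// expRK mulrC.
- by move=> x y xy; rewrite ler_expR ler_pM2r.
- by move=> u y; rewrite mul1r addr0; apply: root_conj_ge.
- by move=> y Q hQ; rewrite mul1r addr0; apply: root_conj_le.
Qed.

(** With [r = exp v] and [u = alpha v] the supremum becomes that of [g] exactly, and [r = 0]
    contributes only 0; hence the constants 1 and 0. *)
Lemma star_equiv : exists h, weight_equiv g
  (dil alpha^-1 (recip (star (dil alpha (EFin \o w))))) h.
Proof.
have av : 0 < alpha^-1 by rewrite invr_gt0.
pose F r y := w (r `^ alpha) - (expR (y / alpha))^-1 * r.
have w0 : w 0 = 0 by rewrite (weight0_eq0 w_weight)// lexx ler01.
have F0 y : F 0 y = 0 by rewrite /F powR0 ?gt_eqF// w0 mulr0 subr0.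
have FE v y : F (expR v) y = phi (alpha * v) - expR ((alpha * v - y) / alpha).
  rewrite /F /powR gt_eqF ?expR_gt0// expRK -expRN -expRD /phi.
  by congr (_ - expR _); field; rewrite gt_eqF.
apply: (@weight_equiv_sup _ _ _ R `[0, +oo[ F 0 1 0 1 0) => //.
- by rewrite /dil /recip powR0 ?(gt_eqF av)// eqxx.
- move=> y; have yE : expR y `^ alpha^-1 = expR (y / alpha).
    by rewrite /powR gt_eqF ?expR_gt0// expRK mulrC.
  by rewrite /dil /recip yE gt_eqF ?expR_gt0.
- by rewrite /= in_itv/= lexx.
- by move=> y; rewrite F0.
- move=> r; rewrite /= in_itv/= andbT => r0 x y xy.
  rewrite lerD2l lerN2 ler_wpM2r// lef_pV2 ?posrE ?expR_gt0//.
  by rewrite ler_expR ler_pM2r.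
- move=> r y; rewrite /= in_itv/= andbT mul1r addr0; move: r.
  by apply: ge0_expR_case => [|v]; rewrite ?F0// FE; apply: root_conj_ge.
- move=> y Q hQ; rewrite mul1r addr0; apply: root_conj_le => u.
  have := hQ (expR (u / alpha)); rewrite /= in_itv/= expR_ge0 => /(_ isT).
  by rewrite FE (mulrC alpha) mulfVK ?gt_eqF.
Qed.

End Main.

Theorem theorem5p16 (R : realType) (w : R -> R) (alpha l0 : R)
    (w_weight : weight0 w) (alpha_gt0 : 0 < alpha) (l0_gt0 : 0 < l0)
    (gamma_gt : (alpha%:E < thilliez_index (wmatrix w l0))%E)
    (w_small : littleo_pinfty w (fun t : R => t `^ alpha^-1)) :
  forall (c l : R), 0 < c -> 0 < l ->
  let s1 := assoc_weight (seq_div (wmatrix w (c * l0)) (gevrey alpha)) in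
  let s2 := hat_star (assoc_weight (wmatrix w l))
                     (assoc_weight (gevrey alpha)) in
  let s3 := hat_star (EFin \o w) (assoc_weight (gevrey alpha)) in
  let s4 := hat_star (EFin \o w) (id_root alpha) in
  let s5 := dil alpha^-1 (recip (star (dil alpha (EFin \o w)))) in
  [/\ admissible s1, admissible s2, admissible s3, admissible s4
    & admissible s5] /\
  forall (F : wclass R) (k : kind), std_class F ->
  [/\ space_matrix F k (fun m => seq_div (wmatrix w m) (gevrey alpha))
        = space_weight F k s1,
      space_weight F k s1 = space_weight F k s2,
      space_weight F k s2 = space_weight F k s3,
      space_weight F k s3 = space_weight F k s4
    & space_weight F k s4 = space_weight F k s5].
Proof.
move=> c l c0 l_gt0 s1 s2 s3 s4 s5.
have [b alpha_lt_b wb] : exists2 b : R, alpha < b &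
    thilliez_exponent (wmatrix w l0) b.
  (* The value 0 adjoined in [thilliez_index] cannot exceed [alpha], so a genuine exponent does. *)
  have [_ [->|[b [_ hb] <-]]] := ereal_sup_gt gamma_gt.
    by rewrite lte_fin ltNge ltW.
  by rewrite lte_fin => ab; exists b.
have glog := root_conj_log w_weight w_small.
have g0 := root_conj_ge0 w_weight alpha_gt0 w_small.
have [h1 e1] := assoc_quotient_equiv w_weight alpha_gt0 w_small l0_gt0 wb
  alpha_lt_b (mulr_gt0 c0 l0_gt0).
have [h2 e2] := hat_star_assoc_equiv w_weight alpha_gt0 w_small l0_gt0 wb
  alpha_lt_b l_gt0.
have [h3 e3] := hat_star_weight_equiv w_weight alpha_gt0 w_small l0_gt0 wb
  alpha_lt_b.
have [h4 e4] := hat_star_root_equiv w_weight alpha_gt0 w_small.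
have [h5 e5] := star_equiv w_weight alpha_gt0 w_small.
split; first by split; [exact: weight_equiv_admissible glog e1
  | exact: weight_equiv_admissible glog e2
  | exact: weight_equiv_admissible glog e3
  | exact: weight_equiv_admissible glog e4
  | exact: weight_equiv_admissible glog e5].
move=> F k FS.
have X0 := space_matrix_conj w_weight alpha_gt0 w_small l0_gt0 wb alpha_lt_b k FS.
have X1 := space_weight_conj k FS g0 glog e1.
have X2 := space_weight_conj k FS g0 glog e2.
have X3 := space_weight_conj k FS g0 glog e3.
have X4 := space_weight_conj k FS g0 glog e4.
have X5 := space_weight_conj k FS g0 glog e5.
split.
- exact (etrans X0 (esym X1)).
- exact (etrans X1 (esym X2)).
- exact (etrans X2 (esym X3)).
- exact (etrans X3 (esym X4)).
- exact (etrans X4 (esym X5)).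
Qed.
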